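(* Let $P$ be a real $n\times n$ orthoprojector matrix (i.e. $P=P^T=P^2$) with $r=\operatorname{rank}P\ge1$, and let $\eta=(\eta_1,\dots,\eta_n)^T$, where the $\eta_i$ are independent random variables with $\mathbf E\eta_i=0$ and $|\eta_i|\le1$ with probability $1$. Then for all $u\ge0$ $$\mathbf P(\eta^TP\eta\ge u^2)\le Q_r(u)<\frac{2e^3}{9}\,\mathbf P(\chi_r\ge u).$$
   Context: $C^2_{conv}$ is the class of all even functions $f:\mathbb R\to\mathbb R$ having a finite and convex second derivative $f''$ on $\mathbb R$. $C^2_{\uparrow,conv}$ is the class of all $f\in C^2_{conv}$ with $f(0)\ge0$ and $f''(0)\ge0$. $\chi_r$ is the nonnegative square root of a random variable having the chi-square distribution with $r$ degrees of freedom. For $u\ge0$, $$Q_r(u)=\inf\{\mathbf E f(\chi_r)/f(u):\ f\in C^2_{\uparrow,conv},\ f(u)>0\}.$$ *)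

(* Defs.v *)
From HB Require Import structures.
From mathcomp Require Import all_boot all_order all_algebra.
From mathcomp Require Import all_classical all_reals all_analysis measurable_realfun.
Set Implicit Arguments.
Unset Strict Implicit.
Unset Printing Implicit Defensive.
Import Order.TTheory GRing.Theory Num.Theory.
Import numFieldNormedType.Exports.
Local Open Scope classical_set_scope.
Local Open Scope ring_scope.

Section C2conv.
Context {R : realType}.
Implicit Type f : R -> R.

Definition C2conv f : Prop :=
  [/\ forall x, f (- x) = f x,
      forall x, derivable f x 1,
      forall x, derivable (derive1 f) x 1 &
      convex_function (setT : set R) (derive1n 2 f)].

Definition C2upconv f : Prop := [/\ C2conv f, 0 <= f 0 & 0 <= derive1n 2 f 0].

End C2conv.

Section chi_law.
Context {R : realType}.
Local Notation mR := (measurableTypeR R).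

Definition add_sqr (xz : mR * mR) : mR := xz.1 + xz.2 ^+ 2.

Lemma measurable_add_sqr : measurable_fun setT add_sqr.
Proof.
apply: (@measurable_funD _ _ R) => //.
by apply: (@measurable_funX _ _ R); exact: measurable_snd.
Qed.

HB.instance Definition _ :=
  isMeasurableFun.Build _ _ _ _ add_sqr measurable_add_sqr.

Definition sqrt_fun (x : mR) : mR := Num.sqrt x.

Lemma measurable_sqrt_fun : measurable_fun setT sqrt_fun.
Proof. by apply: continuous_measurable_fun; exact: sqrt_continuous. Qed.

HB.instance Definition _ :=
  isMeasurableFun.Build _ _ _ _ sqrt_fun measurable_sqrt_fun.

(* The law of Z_1 ^+ 2 + ... + Z_r ^+ 2 for independent standard normal
   Z_1, ..., Z_r : the partial sum and the next Z being independent, their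
   joint law is the product measure. *)
Fixpoint chi_square_prob (r : nat) : probability mR R :=
  if r is s.+1 then
    distribution (chi_square_prob s \x normal_prob (0 : R) 1)%E add_sqr
  else \d_(0 : mR).

Definition chi_prob (r : nat) : probability mR R :=
  distribution (chi_square_prob r) sqrt_fun.

(* An infimum in \bar R, as 'E_(chi_prob r)[f] = +oo for f of fast growth. *)
Definition Q (r : nat) (u : R) : \bar R :=
  ereal_inf [set ('E_(chi_prob r)[f] * (f u)^-1%:E)%E
            | f in [set f : R -> R | C2upconv f /\ 0 < f u]].

End chi_law.

Definition mutually_independent d (T : measurableType d) (R : realType)
    (Pr : probability T R) (n : nat) (X : 'I_n -> {RV Pr >-> R}) : Prop :=
  forall (J : {set 'I_n}) (B : 'I_n -> set R),
    (forall i, measurable (B i)) ->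
    Pr (\bigcap_(i in [set` J]) X i @^-1` B i) =
    (\prod_(i in J) Pr (X i @^-1` B i))%E.

(* Main.v *)
From HB Require Import structures.
Require Import Defs.
From mathcomp Require Import all_boot all_order all_algebra.
From mathcomp Require Import all_classical all_reals all_analysis measurable_realfun.
From mathcomp Require Import ring lra.
Set Implicit Arguments.
Unset Strict Implicit.
Unset Printing Implicit Defensive.
Import Order.TTheory GRing.Theory Num.Theory.
Import numFieldNormedType.Exports.
Local Open Scope classical_set_scope.
Local Open Scope ring_scope.

(** The first inequality is Markov's inequality for [f] in the class, once it is
known that [radial f] of the random vector [P *m eta] has a mean at most
['E_(chi_prob r)[f]]. This is a comparison in two steps. Along any line a radial
function [radial f] is a function of the class in one variable ([C2up_sqrt],
[C2up_profile]): its restriction to a line at distance [p] from the origin is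
[f (Num.sqrt (p ^+ 2 + z ^+ 2))], whose second derivative is convex because it is
so when [f''] is a truncation, and the general case is a limit of positive
combinations of truncations. In particular [radial f] is convex along lines, and
each centered variable bounded by 1 can be replaced by a uniform sign
([le_interpolate], [mean_interpolate]). Next, a function of the class,
symmetrized, lies above a parabola that touches it at 1 and -1
([C2up_square_tangent]), so that a sign can be replaced by a standard normal
variable, whose second moment is 1 ([C2up_sign_le_gauss],
[sign_mean_le_gauss_mean]). The resulting Gaussian vector has covariance [P], and
by rotations its squared norm is chi-square with [\rank P] degrees of freedom
([gauss_mean_projector]). Together this is [projector_tail].

For the second inequality it suffices to exhibit one [f] for each [u]. The chi law
has a density proportional to [x ^+ k * expR (- (x ^+ 2 / 2))] on the positive
half-line ([chi_density]), where [k = r.-1]; this function is log-concave. If [nu]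
is the exponential density, of rate [l], that has at [u] the same value and
beyond [u] the same mass as the chi density, then log-concavity forces the chi
density below [nu] before [u], above it on an interval after [u], and below it
again. Hence a nonnegative nondecreasing function has a smaller mean under the chi
law than under [nu] ([single_crossing]). For truncated powers the mean under [nu]
is explicit ([chi_power_mean_lt]):
the ratio of the mean of [Num.max (x - t) 0 ^+ j] to its value at [u] is below
[expR s * j`! / s ^+ j] times the tail, with [s = l * (u - t)]. For [j = 3] and
[s = 3] this is [2 * expR 3 / 9]. This choice needs [3 <= l * u]; for smaller
[l * u] the exponents 2 and 0 with [t = 0] give less ([expR_lt_mid],
[expR_lt_small]). *)

(** * Differentiation at a point *)

(** The differentiation rules below have their functions written as abstractions
of a point, so that the derivative of a concrete expression is the application
of the rules that follows its syntax, up to a final ring identity. *)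
Section pointwise_derivation.
Context {R : realType}.
Implicit Types (f g : R -> R) (x a b : R).

Lemma der_id x : is_derive x 1 (fun z : R => z) (1 : R).
Proof. exact: is_derive_id. Qed.

Lemma der_cst c x : is_derive x 1 (fun _ : R => c : R) (0 : R).
Proof. exact: is_derive_cst. Qed.

Lemma derD f g x a b : is_derive x 1 f a -> is_derive x 1 g b ->
  is_derive x 1 (fun z => f z + g z) (a + b).
Proof. by move=> ? ?; exact: is_deriveD. Qed.

Lemma derN f x a : is_derive x 1 f a -> is_derive x 1 (fun z => - f z) (- a).
Proof. by move=> ?; exact: is_deriveN. Qed.

Lemma derM f g x a b : is_derive x 1 f a -> is_derive x 1 g b ->
  is_derive x 1 (fun z => f z * g z) (a * g x + f x * b).
Proof.
move=> Df Dg; have := @is_deriveM _ _ f g x 1 a b Df Dg.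
move/is_derive_eq; apply.
by rewrite /GRing.scale/= addrC [g x * a]mulrC.
Qed.

Lemma der_comp f g x a b : is_derive (g x) 1 f a -> is_derive x 1 g b ->
  is_derive x 1 (fun z => f (g z)) (a * b).
Proof. by move=> ? ?; exact: is_derive1_comp. Qed.

Lemma derX n f x a : is_derive x 1 f a ->
  is_derive x 1 (fun z => f z ^+ n.+1) (n.+1%:R * f x ^+ n * a).
Proof.
move=> Df; elim: n => [|n IH].
  by rewrite expr0 !mul1r; under eq_fun do rewrite expr1.
under eq_fun do rewrite exprSr.
by apply: (is_derive_eq (derM IH Df)); rewrite -[n.+2%:R]natr1 exprSr; ring.
Qed.

Lemma derV f x a : f x != 0 -> is_derive x 1 f a ->
  is_derive x 1 (fun z => (f z)^-1) (- a / f x ^+ 2).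
Proof.
move=> f0 [dfx dv]; apply: DeriveDef; first exact: derivableV.
by rewrite deriveV// dv /GRing.scale/= mulNr mulrC mulNr.
Qed.

Lemma is_derive_continuous f x a : is_derive x 1 f a -> {for x, continuous f}.
Proof. by move=> ?; apply/differentiable_continuous/derivable1_diffP. Qed.

(** A function dominated by the square of the distance to a point is flat
there; this differentiates truncated powers at their knot. *)
Lemma is_derive_flat f x : (forall z, `|z - x| <= 1 -> `|f z| <= (z - x) ^+ 2) ->
  is_derive x 1 f (0 : R).
Proof.
move=> fC.
have fx : f x = 0.
  have := fC x; rewrite subrr normr0 expr0n/= => /(_ ler01) fx0.
  by apply/eqP; rewrite -normr_le0.
have cvg0 : h^-1 *: (f (h *: (1 : R) + x) - f x) @[h --> (0:R)^'] --> (0 : R).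
  apply/cvgr0Pnorm_le => e e0; near=> h.
  have h0 : h != 0 by near: h; exact: nbhs_dnbhs_neq.
  have h1 : `|h| <= 1.
    by near: h; exact: dnbhs0_le.
  have he : `|h| <= e.
    by near: h; exact: dnbhs0_le.
  rewrite fx subr0 normrM normfV mulrC ler_pdivrMr ?normr_gt0//.
  rewrite [h *: 1]mulr1.
  have := fC (h + x); rewrite addrK => /(_ h1) /le_trans; apply.
  by rewrite -(real_normK (num_real h)) expr2 ler_wpM2r.
apply: DeriveDef; first by apply/cvg_ex; exists 0.
exact/cvg_lim.
Unshelve. all: by end_near. Qed.

(** Truncated powers are differentiable from exponent 2 on, also at the knot,
where they are flat. *)
Lemma is_derive_max0 n x :
  is_derive x 1 (fun z : R => Num.max z 0 ^+ n.+2) (n.+2%:R * Num.max x 0 ^+ n.+1).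
Proof.
have [x0|x0|->] := ltgtP x 0.
- rewrite expr0n/= mulr0.
  apply: (near_eq_is_derive _ (der_cst 0 x)).
  by near=> z; rewrite /= max_r ?expr0n//; apply/ltW; near: z; exact: lt_nbhsl.
- have D : is_derive x 1 (fun z : R => z ^+ n.+2) (n.+2%:R * x ^+ n.+1).
    by apply: (is_derive_eq (derX n.+1 (der_id x))); rewrite mulr1.
  apply: (near_eq_is_derive _ D).
  by near=> z; rewrite /= max_l//; apply/ltW; near: z; exact: lt_nbhsr.
- rewrite expr0n/= mulr0.
  apply: is_derive_flat => z; rewrite subr0 => z1.
  have m1 : `|Num.max z 0| <= `|z|.
    by case: (leP z 0) => ?; rewrite ?normr0.
  rewrite normrX -(real_normK (num_real z)).
  apply: (@le_trans _ _ (`|z| ^+ n.+2)); first by rewrite lerXn2r ?nnegrE.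
  by rewrite -addn2 exprD ler_piMl// exprn_ile1.
Unshelve. all: by end_near. Qed.

End pointwise_derivation.

(** * Even functions with a convex second derivative *)

Section convexity.
Context {R : realType}.
Implicit Types (f df k : R -> R) (x y a b s : R).

(** Convexity on the line with an unbundled weight, which arithmetic tactics can
handle. *)
Definition convexR k := forall s x y, 0 <= s <= 1 ->
  k (s * x + (1 - s) * y) <= s * k x + (1 - s) * k y.

Lemma midpoint_weight x y : 0 <= x -> x <= y -> 0 < y ->
  0 <= (1 + x / y) / 2 <= 1.
Proof.
move=> x0 xy y0; have h0 : 0 <= x / y by rewrite divr_ge0// ltW.
have h1 : x / y <= 1 by rewrite ler_pdivrMr// mul1r.
lra.
Qed.

Lemma convex_functionP k :
  convex_function (setT : set R) k <-> convexR k.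
Proof.
split=> [kcvx s x y s01|kcvx t x y _ _].
  have := kcvx (Itv01 (proj1 (andP s01)) (proj2 (andP s01))) x y.
  by rewrite !inE => /(_ I I).
by have := kcvx t%:num x y; apply; rewrite ge0 le1.
Qed.

Lemma MVT_everywhere f df a b : (forall x, is_derive x 1 f (df x)) -> a < b ->
  exists2 c, a < c < b & f b - f a = df c * (b - a).
Proof.
move=> Df ab; have [|c cab ?] := @MVT R f df a b ab (fun x _ => Df x).
  by apply: continuous_subspaceT => x; exact: (is_derive_continuous (Df x)).
by exists c; first by move: cab; rewrite in_itv.
Qed.

Lemma derive_ge0_nondecreasing f df a : (forall x, is_derive x 1 f (df x)) ->
  (forall x, a < x -> 0 <= df x) ->
  forall x y, a <= x -> x <= y -> f x <= f y.
Proof.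
move=> Df df0 x y ax; rewrite le_eqVlt => /orP[/eqP->//|xy].
have [c /andP[xc cy] fE] := MVT_everywhere Df xy.
rewrite -subr_ge0 fE mulr_ge0 ?subr_ge0 ?(ltW xy)// df0//.
exact: le_lt_trans xc.
Qed.

(** A function whose derivative increases beyond [a] lies there above its
tangents, by the mean value theorem on either side of the point of contact. *)
Lemma derive_nondecreasing_tangent f df a : (forall x, is_derive x 1 f (df x)) ->
  (forall x y, a <= x -> x <= y -> df x <= df y) ->
  forall x y, a <= x -> a <= y -> f x + df x * (y - x) <= f y.
Proof.
move=> Df dfnd x y ax ay; have [xy|yx|->] := ltgtP x y; last by rewrite subrr mulr0 addr0.
- have [c /andP[xc cy] fE] := MVT_everywhere Df xy.
  rewrite -lerBrDl fE ler_wpM2r ?subr_ge0 ?(ltW xy)//.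
  by apply: dfnd => //; exact: ltW.
- have [c /andP[yc cx] fE] := MVT_everywhere Df yx.
  have -> : f y = f x + df c * (y - x).
    by rewrite -(opprB x y) mulrN -fE; ring.
  rewrite lerD2l ler_wnM2r ?subr_le0 ?(ltW yx)//.
  by apply: dfnd; [exact: le_trans (ltW yc)|exact: ltW].
Qed.

Lemma derive_nondecreasing_convex f df a : (forall x, is_derive x 1 f (df x)) ->
  (forall x y, a <= x -> x <= y -> df x <= df y) ->
  forall s x y, 0 <= s <= 1 -> a <= x -> a <= y ->
  f (s * x + (1 - s) * y) <= s * f x + (1 - s) * f y.
Proof.
move=> Df dfnd s x y /andP[s0 s1] ax ay; set z := s * x + _.
have az : a <= z.
  have -> : a = s * a + (1 - s) * a by ring.
  by rewrite lerD// ler_wpM2l// subr_ge0.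
have := derive_nondecreasing_tangent Df dfnd az ax.
move=> /(ler_wpM2l s0) fx.
have := derive_nondecreasing_tangent Df dfnd az ay.
have s1' : 0 <= 1 - s by rewrite subr_ge0.
move=> /(ler_wpM2l s1') fy.
apply: le_trans (lerD fx fy); rewrite le_eqVlt; apply/orP; left; apply/eqP.
by rewrite /z; ring.
Qed.

End convexity.

Section C2up.
Context {R : realType}.
Implicit Types (f : R -> R) (x y : R).

(** Membership in [C2upconv] with the two derivatives named; see [C2upconvP]. *)
Definition C2up f f1 f2 : Prop :=
  [/\ forall x, f (- x) = f x,
      forall x, is_derive x 1 f (f1 x),
      forall x, is_derive x 1 f1 (f2 x),
      convexR f2 & 0 <= f 0 /\ 0 <= f2 0].

Lemma C2upconvP f : C2upconv f <-> exists f1 f2, C2up f f1 f2.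
Proof.
split=> [[[fN df ddf /convex_functionP cf] f0 f20]|[f1 [f2 [fN df ddf cf [f0 f20]]]]].
  exists (derive1 f), (derive1n 2 f); split; [exact: fN|move=> x|move=> x|exact: cf|by []].
    by rewrite derive1E; exact/derivableP/df.
  by rewrite /= derive1E; exact/derivableP/ddf.
have f1E : derive1 f = f1 by apply/funext => x; rewrite derive1E; apply: derive_val.
have f2E : derive1n 2 f = f2.
  by apply/funext => x; rewrite /= f1E derive1E; apply: derive_val.
split; [split; [exact: fN|move=> x|rewrite f1E => x|]|exact: f0|by rewrite f2E].
- exact: (@ex_derive _ _ _ _ _ _ _ (df x)).
- exact: (@ex_derive _ _ _ _ _ _ _ (ddf x)).
- by rewrite f2E; exact/convex_functionP.
Qed.

Variables (f f1 f2 : R -> R).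
Hypothesis fup : C2up f f1 f2.

Lemma C2up_derive_odd x : f1 (- x) = - f1 x.
Proof.
have [fN df _ _ _] := fup.
have D := der_comp (df (- x)) (derN (der_id x)).
have DD : is_derive x 1 f (f1 (- x) * -1).
  by rewrite (_ : f = fun z => f (- z)) //; apply/funext => z; rewrite fN.
have [_ <-] := df x; have [_ ->] := DD; ring.
Qed.

Lemma C2up_derive2_even x : f2 (- x) = f2 x.
Proof.
have [_ _ ddf _ _] := fup.
have D := derN (der_comp (ddf (- x)) (derN (der_id x))).
have DD : is_derive x 1 f1 (- (f2 (- x) * -1)).
  rewrite (_ : f1 = fun z => - f1 (- z)) //.
  by apply/funext => z; rewrite C2up_derive_odd opprK.
have [_ <-] := ddf x; have [_ ->] := DD; ring.
Qed.

(** Evenness makes [f2 x], for [0 <= x <= y], a convex combination of [f2 y] and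
[f2 (- y)], which are equal; with [0 <= f2 0] this gives the sign of [f2], then
the monotonicity and the convexity of [f]. *)
Lemma C2up_derive2_nondecreasing x y : 0 <= x -> x <= y -> f2 x <= f2 y.
Proof.
have [_ _ _ cf _] := fup => x0; rewrite le_eqVlt => /orP[/eqP->//|xy].
have y0 : 0 < y by exact: le_lt_trans xy.
have s01 : 0 <= (1 + x / y) / 2 <= 1.
  exact: midpoint_weight x0 (ltW xy) y0.
have := cf _ y (- y) s01; rewrite C2up_derive2_even -mulrDl.
rewrite subrKC mul1r; congr (f2 _ <= _).
by field; rewrite gt_eqF.
Qed.

Lemma C2up_derive2_ge0 x : 0 <= f2 x.
Proof.
have [_ _ _ _ [_ f20]] := fup.
wlog x0 : x / 0 <= x => [hw|]; last exact/(le_trans f20)/C2up_derive2_nondecreasing.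
by have [/hw//|/ltW x0] := leP 0 x; rewrite -C2up_derive2_even hw ?oppr_ge0.
Qed.

Lemma C2up_derive_nondecreasing x y : x <= y -> f1 x <= f1 y.
Proof.
have [_ _ ddf _ _] := fup => xy.
apply: (derive_ge0_nondecreasing ddf (a := x)) => // z _; exact: C2up_derive2_ge0.
Qed.

Lemma C2up_derive0 : f1 0 = 0.
Proof. by have := C2up_derive_odd 0; rewrite oppr0; lra. Qed.

Lemma C2up_nondecreasing x y : 0 <= x -> x <= y -> f x <= f y.
Proof.
have [_ df _ _ _] := fup; apply: (derive_ge0_nondecreasing df) => z z0.
by rewrite -C2up_derive0; apply: C2up_derive_nondecreasing; exact: ltW.
Qed.

Lemma C2up_convex : convexR f.
Proof.
have [_ df _ _ _] := fup => s x y s01.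
apply: (derive_nondecreasing_convex df (a := Num.min x y)) => //.
- by move=> a b _; exact: C2up_derive_nondecreasing.
- by rewrite ge_min lexx.
- by rewrite ge_min lexx orbT.
Qed.

Lemma C2up_ge0 x : 0 <= f x.
Proof.
have [fN _ _ _ [f0 _]] := fup.
wlog x0 : x / 0 <= x => [hw|]; last exact/(le_trans f0)/C2up_nondecreasing.
by have [/hw//|/ltW x0] := leP 0 x; rewrite -fN hw ?oppr_ge0.
Qed.

Lemma C2up_continuous : continuous f.
Proof. by have [_ df _ _ _] := fup => x; exact: (is_derive_continuous (df x)). Qed.

(** For a random [t] of mean 0 the right-hand side has the mean that results from
replacing [t] by a uniform sign. *)
Lemma C2up_le_sign x c t : -1 <= t <= 1 ->
  f (x + t * c) <= (1 + t) / 2 * f (x + c) + (1 - t) / 2 * f (x - c).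
Proof.
move=> t1; have s01 : 0 <= (1 + t) / 2 <= 1 by lra.
have -> : (1 - t) / 2 = 1 - (1 + t) / 2 by field.
by apply: le_trans (C2up_convex _ _ s01); rewrite le_eqVlt; apply/orP; left; apply/eqP;
  congr f; field.
Qed.

(** In the variable [t ^+ 2] the symmetrisation [K] of [f] is convex, so that
it lies above its tangent at [t = 1]: [K' t - K' 1 * t] has a nondecreasing
derivative and vanishes at 0 and 1, hence is nonpositive between 0 and 1 and
nonnegative beyond. *)
Lemma C2up_square_tangent x c : exists2 m : R, 0 <= m &
  forall t : R, f (x + c) + f (x - c) + m * t ^+ 2 <= f (x + t * c) + f (x - t * c) + m.
Proof.
have [_ df ddf cf _] := fup.
pose K t := f (x + t * c) + f (x - t * c).
pose K1 t := c * (f1 (x + t * c) - f1 (x - t * c)).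
pose K2 t := c ^+ 2 * (f2 (x + t * c) + f2 (x - t * c)).
have dl (t : R) : is_derive t 1 (fun t : R => x + t * c) c.
  by apply: (is_derive_eq (derD (der_cst x t) (derM (der_id t) (der_cst c t)))); ring.
have dr (t : R) : is_derive t 1 (fun t : R => x - t * c) (- c).
  by apply: (is_derive_eq (derD (der_cst x t) (derN (derM (der_id t) (der_cst c t))))); ring.
have dK (t : R) : is_derive t 1 K (K1 t).
  by apply: (is_derive_eq (derD (der_comp (df _) (dl t)) (der_comp (df _) (dr t))));
    rewrite /K1; ring.
have dK1 (t : R) : is_derive t 1 K1 (K2 t).
  apply: (is_derive_eq (derM (der_cst c t) (derD (der_comp (ddf _) (dl t)) (derN (der_comp
    (ddf _) (dr t)))))).
  by rewrite /K2; ring.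
have K2nd a b : 0 <= a -> a <= b -> K2 a <= K2 b.
  move=> a0; rewrite le_eqVlt => /orP[/eqP->//|ab].
  have b0 : 0 < b by exact: le_lt_trans ab.
  have s01 : 0 <= (1 + a / b) / 2 <= 1.
    exact: midpoint_weight a0 (ltW ab) b0.
  have b1 : b != 0 by rewrite gt_eqF.
  rewrite /K2 ler_wpM2l ?sqr_ge0//.
  have := lerD (cf _ (x + b * c) (x - b * c) s01) (cf _ (x - b * c) (x + b * c) s01).
  rewrite (_ : _ * (x + b * c) + _ = x + a * c); last by field.
  rewrite (_ : _ * (x - b * c) + _ = x - a * c); last by field.
  by move=> /le_trans; apply; rewrite le_eqVlt; apply/orP; left; apply/eqP; ring.
have K10 : K1 0 = 0 by rewrite /K1 mul0r addr0 subr0 subrr mulr0.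
have K2ge0 t : 0 <= K2 t by rewrite mulr_ge0 ?sqr_ge0// addr_ge0// C2up_derive2_ge0.
have m0 : 0 <= K1 1.
  rewrite -K10; apply: (derive_ge0_nondecreasing dK1 (a := 0)) => //.
pose N t := K1 t - K1 1 * t.
have dN (t : R) : is_derive t 1 N (K2 t - K1 1).
  by apply: (is_derive_eq (derD (dK1 t) (derN (derM (der_cst (K1 1) t) (der_id t))))); ring.
have N0 : N 0 = 0 by rewrite /N K10 mulr0 subrr.
have N1 : N 1 = 0 by rewrite /N mulr1 subrr.
have Nle0 t : 0 < t -> t < 1 -> N t <= 0.
  move=> t0 t1; rewrite leNgt; apply/negP => Nt.
  have [a /andP[a0 at_] aE] := MVT_everywhere dN t0.
  have [b /andP[tb b1] bE] := MVT_everywhere dN t1.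
  have : K2 a <= K2 b by apply: K2nd; [exact: ltW|exact/ltW/(lt_trans at_)].
  have : 0 < (K2 a - K1 1) by rewrite -(pmulr_lgt0 _ t0) -[X in _ * X]subr0 -aE N0 subr0.
  have : (K2 b - K1 1) < 0.
    by rewrite -(pmulr_llt0 _ (_ : 0 < 1 - t)) ?subr_gt0// -bE N1 sub0r oppr_lt0.
  lra.
have Nge0 t : 1 < t -> 0 <= N t.
  move=> t1; rewrite leNgt; apply/negP => Nt.
  have [a /andP[a0 a1] aE] := MVT_everywhere dN (@ltr01 R).
  have [b /andP[b1 bt] bE] := MVT_everywhere dN t1.
  have : K2 a <= K2 b by apply: K2nd; [exact: ltW|exact/ltW/(lt_trans a1)].
  have : K2 a - K1 1 = 0 by move: aE; rewrite N1 N0; lra.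
  have : (K2 b - K1 1) < 0.
    by rewrite -(pmulr_llt0 _ (_ : 0 < t - 1)) ?subr_gt0// -bE N1 subr0.
  lra.
pose G t := K t - K1 1 / 2 * t ^+ 2.
have dG (t : R) : is_derive t 1 G (N t).
  apply: (is_derive_eq (derD (dK t) (derN (derM (der_cst (K1 1 / 2) t) (derX 1 (der_id t)))))).
  by rewrite /N; field.
have G1 t : 0 <= t -> G 1 <= G t.
  move=> t0; have [t1|t1|->//] := ltgtP t 1.
    have [a /andP[ta a1] aE] := MVT_everywhere dG t1.
    rewrite -subr_le0 aE mulr_le0_ge0 ?subr_ge0 ?(ltW t1)//.
    by apply: Nle0 => //; exact: le_lt_trans ta.
  have [a /andP[ta a1] aE] := MVT_everywhere dG t1.
  by rewrite -subr_ge0 aE mulr_ge0 ?(Nge0 _ ta)// subr_ge0 ltW.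
exists (K1 1 / 2); first by rewrite divr_ge0.
move=> t; wlog t0 : t / 0 <= t => [hw|].
  have [/hw//|/ltW t0] := leP 0 t.
  have := hw (- t); rewrite oppr_ge0 => /(_ t0).
  by rewrite sqrrN mulNr opprK [f (x - _) + f _]addrC.
by have := G1 _ t0; rewrite /G /K expr1n !mul1r mulr1; lra.
Qed.

End C2up.

(** * Restriction of radial functions to lines *)

(** For [f] in the class and [w] the square root below, the second derivative of
[fun z => f (w z)] is [lift2 f2 f1], a positive linear expression in the pair
[(f2, f1)]. Its convexity only has to be checked when [f2] is constant, where it
is constant, or a truncation [fun x => Num.max (x - t) 0]: on bounded sets [f2] is
a uniform limit of nonnegative combinations of these. *)
Section lift.
Context {R : realType}.
Variable p : R.
Hypothesis p0 : 0 < p.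
Implicit Types (z s t : R).

Let w z := Num.sqrt (p ^+ 2 + z ^+ 2).

Let sum_gt0 z : 0 < p ^+ 2 + z ^+ 2.
Proof. by rewrite ltr_wpDr ?sqr_ge0// exprn_gt0. Qed.

Let w_gt0 z : 0 < w z.
Proof. by rewrite sqrtr_gt0. Qed.

Let w_neq0 z : w z != 0.
Proof. by rewrite gt_eqF. Qed.

Let w_sqr z : w z ^+ 2 = p ^+ 2 + z ^+ 2.
Proof. by rewrite sqr_sqrtr// ltW. Qed.

Let le_p_w z : p <= w z.
Proof.
by rewrite -(@ler_pXn2r _ 2) ?nnegrE ?(ltW p0) ?(ltW (w_gt0 z))// w_sqr lerDl sqr_ge0.
Qed.

Let is_derive_w z : is_derive z 1 w (z / w z).
Proof.
have D := derD (der_cst (p ^+ 2) z) (derX 1 (der_id z)).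
apply: (is_derive_eq (@der_comp R _ (fun z => p ^+ 2 + z ^+ 2) _ _ _ (is_derive1_sqrt
  (sum_gt0 z)) D)).
by rewrite -/(w z); field.
Qed.

Definition lift2 (k F : R -> R) z :=
  k (w z) * (z ^+ 2 / w z ^+ 2) + F (w z) * (p ^+ 2 / w z ^+ 3).

Section truncated.
Variable t : R.
Hypothesis t0 : 0 <= t.

(** Beyond the knot the lift of the truncation at [t] is [th]; [dth] and [ddth]
are its first two derivatives. *)
Let th z := w z - t - p ^+ 2 / 2 * (w z)^-1 + t ^+ 2 * p ^+ 2 / 2 * (w z)^-1 ^+ 3.
Let dth z :=
  z / w z * (1 + p ^+ 2 / (2 * w z ^+ 2) - 3 * t ^+ 2 * p ^+ 2 / (2 * w z ^+ 4)).
Let ddth z := 3 * p ^+ 2 / (2 * w z ^+ 5) *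
  (4 * t ^+ 2 + p ^+ 2 - 5 * p ^+ 2 * t ^+ 2 / w z ^+ 2).

Let is_derive_th z : is_derive z 1 th (dth z).
Proof.
have D := derV (w_neq0 z) (is_derive_w z).
apply: (is_derive_eq (derD (derD (derD (is_derive_w z) (der_cst (- t) z))
  (derN (derM (der_cst (p ^+ 2 / 2) z) D)))
  (derM (der_cst (t ^+ 2 * p ^+ 2 / 2) z) (derX 2 D)))).
by rewrite /dth; field.
Qed.

Let is_derive_dth z : is_derive z 1 dth (ddth z).
Proof.
have D := derV (w_neq0 z) (is_derive_w z).
have -> : dth = fun z => z * (w z)^-1 * (1 + p ^+ 2 / 2 * (w z)^-1 ^+ 2
    - 3 * t ^+ 2 * p ^+ 2 / 2 * (w z)^-1 ^+ 4).
  by apply/funext => y; rewrite /dth; field.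
apply: (is_derive_eq (derM (derM (der_id z) D) (derD (derD (der_cst 1 z)
  (derM (der_cst (p ^+ 2 / 2) z) (derX 1 D)))
  (derN (derM (der_cst (3 * t ^+ 2 * p ^+ 2 / 2) z) (derX 3 D)))))).
have zE : z ^+ 2 = w z ^+ 2 - p ^+ 2 by rewrite w_sqr addrAC subrr add0r.
transitivity ((w z)^-1 * (1 + p ^+ 2 / (2 * w z ^+ 2) - 3 * t ^+ 2 * p ^+ 2 / (2 * w z ^+ 4))
  - z ^+ 2 / w z ^+ 3 * (1 + p ^+ 2 / (2 * w z ^+ 2) - 3 * t ^+ 2 * p ^+ 2 / (2 * w z ^+ 4))
  + z ^+ 2 * (6 * t ^+ 2 * p ^+ 2 / w z ^+ 7 - p ^+ 2 / w z ^+ 5)).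
  by field.
by rewrite zE /ddth; field.
Qed.

(** The value of [`|z|] at which [w z] reaches [t], or 0 if [w] exceeds [t]
everywhere. *)
Let zt := Num.sqrt (t ^+ 2 - p ^+ 2).

Let knot z : zt <= `|z| -> t <= w z.
Proof.
move=> ztz; rewrite -(@ler_pXn2r _ 2) ?nnegrE ?(ltW (w_gt0 z))// w_sqr.
have [tp|pt] := leP (t ^+ 2) (p ^+ 2); first by rewrite ler_wpDr ?sqr_ge0.
rewrite -(real_normK (num_real z)) addrC -lerBlDr.
have <- : zt ^+ 2 = t ^+ 2 - p ^+ 2 by rewrite sqr_sqrtr// subr_ge0 ltW.
by rewrite ler_pXn2r ?nnegrE// sqrtr_ge0.
Qed.

Let before_knot z : `|z| < zt -> w z < t /\ w zt = t.
Proof.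
move=> zzt.
have zt0 : 0 < zt by exact: le_lt_trans zzt.
have d0 : 0 < t ^+ 2 - p ^+ 2 by rewrite -sqrtr_gt0.
have ztE : zt ^+ 2 = t ^+ 2 - p ^+ 2 by rewrite sqr_sqrtr// ltW.
split; last by rewrite /w ztE subrKC sqrtr_sqr ger0_norm.
rewrite -(@ltr_pXn2r _ 2) ?nnegrE ?(ltW (w_gt0 z))// w_sqr.
by rewrite addrC -ltrBrDr -ztE -(real_normK (num_real z)) ltr_pXn2r ?nnegrE ?sqrtr_ge0.
Qed.

Let zt_ge0 : 0 <= zt. Proof. exact: sqrtr_ge0. Qed.

Let p2t2 z : zt <= z -> p ^+ 2 * t ^+ 2 / w z ^+ 2 <= p ^+ 2 /\
  p ^+ 2 * t ^+ 2 / w z ^+ 2 <= t ^+ 2.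
Proof.
move=> ztz; have wt : t <= w z by apply: knot; rewrite ger0_norm// (le_trans zt_ge0).
rewrite !ler_pdivrMr ?exprn_gt0//; split.
  by rewrite ler_wpM2l ?sqr_ge0// ler_pXn2r ?nnegrE ?(ltW (w_gt0 z)).
by rewrite mulrC ler_wpM2l ?sqr_ge0// ler_pXn2r ?nnegrE ?(ltW p0) ?(ltW (w_gt0 z)).
Qed.

Let th_nondecreasing a b : zt <= a -> a <= b -> th a <= th b.
Proof.
apply: (derive_ge0_nondecreasing is_derive_th) => z /ltW ztz.
have z0 : 0 <= z by exact: le_trans ztz.
rewrite mulr_ge0// ?divr_ge0 ?(ltW (w_gt0 z))//.
have [h1 _] := p2t2 ztz.
have h2 : p ^+ 2 / w z ^+ 2 <= 1.
  by rewrite ler_pdivrMr ?exprn_gt0// mul1r ler_pXn2r ?nnegrE ?(ltW p0) ?(ltW (w_gt0 z)).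
have -> : 3 * t ^+ 2 * p ^+ 2 / (2 * w z ^+ 4) =
  3 / 2 * ((p ^+ 2 * t ^+ 2 / w z ^+ 2) / w z ^+ 2) by field.
have -> : p ^+ 2 / (2 * w z ^+ 2) = (p ^+ 2 / w z ^+ 2) / 2 by field.
have : p ^+ 2 * t ^+ 2 / w z ^+ 2 / w z ^+ 2 <= p ^+ 2 / w z ^+ 2.
  by rewrite ler_pM2r// invr_gt0 exprn_gt0.
by lra.
Qed.

Let dth_nondecreasing a b : zt <= a -> a <= b -> dth a <= dth b.
Proof.
apply: (derive_ge0_nondecreasing is_derive_dth) => z /ltW ztz.
have [h1 h2] := p2t2 ztz.
rewrite mulr_ge0//.
  by rewrite divr_ge0// mulr_ge0// ?sqr_ge0// exprn_ge0// ltW.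
have -> : 5 * p ^+ 2 * t ^+ 2 / w z ^+ 2 = 5 * (p ^+ 2 * t ^+ 2 / w z ^+ 2) by rewrite !mulrA.
by lra.
Qed.

(** The lift vanishes before the knot, hence is [th] at the maximum of [`|z|] and
[zt]: a convex nondecreasing function of a convex one. *)
Let kF z := lift2 (fun x => Num.max (x - t) 0)
  (fun x => Num.max (x - t) 0 ^+ 2 / 2) z.

Let kFE z : kF z = th (Num.max `|z| zt).
Proof.
have thN y : th `|y| = th y by rewrite /th /w real_normK// num_real.
have [zzt|ztz] := ltP `|z| zt.
  have [wt ztE] := before_knot zzt.
  rewrite /kF /lift2 max_r ?subr_le0 ?ltW// /th ztE.
  have t_neq0 : t != 0 by exact/lt0r_neq0/(lt_trans (w_gt0 z)).
  by field; rewrite t_neq0 w_neq0.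
rewrite thN /kF /lift2 max_l ?subr_ge0 ?knot// /th.
have -> : z ^+ 2 = w z ^+ 2 - p ^+ 2 by rewrite w_sqr addrAC subrr add0r.
by field.
Qed.

Lemma lift2_truncated_convex : convexR kF.
Proof.
move=> s x y s01; rewrite !kFE.
have [s0 s1] := andP s01.
have s1' : 0 <= 1 - s by rewrite subr_ge0.
have M z : zt <= Num.max `|z| zt by rewrite le_max lexx orbT.
apply: (le_trans _ (derive_nondecreasing_convex is_derive_th dth_nondecreasing s01 (M x)
  (M y))).
apply: th_nondecreasing => //.
rewrite ge_max; apply/andP; split.
  apply: (le_trans (ler_normD _ _)); rewrite !normrM (ger0_norm s0) (ger0_norm s1').
  by rewrite lerD// ler_wpM2l// le_max lexx.
rewrite [leLHS](_ : zt = s * zt + (1 - s) * zt); last by ring.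
by rewrite lerD// ler_wpM2l.
Qed.

End truncated.

(** A nonnegative combination of truncations, encoded by its coefficients and
knots, and its primitive vanishing at 0. *)
Let hinge (l : seq (R * R)) x := \sum_(ct <- l) ct.1 * Num.max (x - ct.2) 0.
Let hinge_int (l : seq (R * R)) x :=
  \sum_(ct <- l) ct.1 * (Num.max (x - ct.2) 0 ^+ 2 / 2).

Let is_derive_hinge_int l (x : R) : is_derive x 1 (hinge_int l) (hinge l x).
Proof.
elim: l => [|[c t] l IH].
  rewrite /hinge big_nil (_ : hinge_int _ = fun=> 0); first exact: der_cst.
  by apply/funext => y; rewrite /hinge_int big_nil.
rewrite /hinge big_cons -/(hinge l x).
rewrite (_ : hinge_int _ = fun y => c * (Num.max (y - t) 0 ^+ 2 / 2) + hinge_int l y);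
  last first.
  by apply/funext => y; rewrite /hinge_int big_cons.
apply: (is_derive_eq (derD (derM (der_cst c x) (derM (@der_comp R (fun z => Num.max z 0 ^+ 2)
  (fun y => y - t) x _ _ (is_derive_max0 0 _) (derD (der_id x) (der_cst (- t) x)))
  (der_cst 2^-1 x))) IH)).
by rewrite /=; field.
Qed.

Let hinge_convex l : (forall ct, ct \in l -> 0 <= ct.1 /\ 0 <= ct.2) ->
  convexR (lift2 (hinge l) (hinge_int l)).
Proof.
elim: l => [_ s x y _|[c t] l IH hl s x y s01].
  by rewrite /lift2 /hinge /hinge_int !big_nil; lra.
have [c0 t0] := hl (c, t) (mem_head _ _).
have hl' ct : ct \in l -> 0 <= ct.1 /\ 0 <= ct.2.
  by move=> ctl; apply: hl; rewrite inE ctl orbT.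
have E z : lift2 (hinge ((c, t) :: l)) (hinge_int ((c, t) :: l)) z =
  c * lift2 (fun x => Num.max (x - t) 0) (fun x => Num.max (x - t) 0 ^+ 2 / 2) z +
  lift2 (hinge l) (hinge_int l) z.
  by rewrite /lift2 /hinge /hinge_int !big_cons/=; ring.
rewrite !E; have := IH hl' s x y s01.
have /= Hc := ler_wpM2l c0 (lift2_truncated_convex t0 x y s01).
move=> Hl; apply: (le_trans (lerD Hc Hl)).
by rewrite le_eqVlt; apply/orP; left; apply/eqP; ring.
Qed.

Variables f f1 f2 : R -> R.
Hypothesis fup : C2up f f1 f2.

Let slope (d : R) j := (f2 (j.+1%:R * d) - f2 (j%:R * d)) / d.

Let slope_nondecreasing d j : 0 < d -> slope d j <= slope d j.+1.
Proof.
move=> d0; rewrite ler_pM2r ?invr_gt0//.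
have [_ _ _ cf _] := fup.
have h : 0 <= (1 / 2 : R) <= 1 by lra.
have := cf _ (j%:R * d) (j.+2%:R * d) h.
rewrite (_ : _ * _ + _ = j.+1%:R * d); last by rewrite -[j.+2%:R]natr1 -[j.+1%:R]natr1; field.
by lra.
Qed.

Let slope_ge0 d j : 0 < d -> 0 <= slope d j.
Proof.
move=> d0; rewrite divr_ge0 ?(ltW d0)// subr_ge0.
apply: (C2up_derive2_nondecreasing fup); first by rewrite mulr_ge0// ltW.
by rewrite ler_wpM2r ?(ltW d0)// ler_nat.
Qed.

(** Linear interpolation of [f2] on the grid of step [d] up to [N%:R * d]. By
convexity the slopes [sg] increase, so that extending the grid by one node adds
a truncation with the nonnegative coefficient [slope d N - sg]. *)
Let grid_approx d N : 0 < d -> exists l : seq (R * R), exists2 sg,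
  [/\ 0 <= sg, sg <= slope d N & forall ct, ct \in l -> 0 <= ct.1 /\ 0 <= ct.2] &
  (forall x, N%:R * d <= x ->
        f2 0 + hinge l x = f2 (N%:R * d) + sg * (x - N%:R * d)) /\
  (forall x, 0 <= x <= N%:R * d -> `|f2 x - (f2 0 + hinge l x)| <= slope d N * d).
Proof.
move=> d0; have f2nd := C2up_derive2_nondecreasing fup.
elim: N => [|N [l [sg [sg0 sgN lge0] [lbeyond lbefore]]]].
  exists [::], 0; split => //; first exact: slope_ge0.
    by move=> x _; rewrite /hinge big_nil mul0r; ring.
  move=> x; rewrite mul0r => /le_anti<-.
  by rewrite /hinge big_nil addr0 subrr normr0 mulr_ge0 ?slope_ge0// ltW.
pose a := N%:R * d.
have a0 : 0 <= a by rewrite mulr_ge0// ltW.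
have bE : N.+1%:R * d = a + d by rewrite -natr1 mulrDl mul1r.
have sE : slope d N * d = f2 (a + d) - f2 a by rewrite /slope bE divfK// gt_eqF.
have hE x : hinge ((slope d N - sg, a) :: l) x =
    (slope d N - sg) * Num.max (x - a) 0 + hinge l x.
  by rewrite /hinge big_cons.
exists ((slope d N - sg, a) :: l), (slope d N).
  split; [exact: slope_ge0|exact: slope_nondecreasing|].
  move=> ct; rewrite inE => /orP[/eqP->/=|/lge0//].
  by rewrite subr_ge0.
have beyond x : a <= x -> f2 0 + hinge ((slope d N - sg, a) :: l) x =
    f2 a + slope d N * (x - a).
  move=> ax; rewrite hE max_l ?subr_ge0// addrCA lbeyond// -/a; ring.
split=> x.
  rewrite bE => bx; rewrite beyond; last by rewrite (le_trans _ bx)// lerDl ltW.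
  have -> : f2 (a + d) = f2 a + slope d N * d by rewrite sE; ring.
  by ring.
rewrite bE => /andP[x0 xb].
apply: (@le_trans _ _ (slope d N * d));
  last by rewrite ler_wpM2r ?(ltW d0)// slope_nondecreasing.
have [xa|ax] := leP x a.
  by rewrite hE max_r ?subr_le0// mulr0 add0r lbefore// x0.
rewrite beyond ?(ltW ax)//.
have h1 : f2 a <= f2 x by apply: f2nd => //; exact: ltW.
have h2 : f2 x <= f2 (a + d) by apply: f2nd.
have h3 : 0 <= slope d N * (x - a) by rewrite mulr_ge0 ?slope_ge0// subr_ge0 ltW.
have h4 : slope d N * (x - a) <= slope d N * d by rewrite ler_wpM2l ?slope_ge0//; lra.
by rewrite ler_norml; lra.
Qed.

(** The error of interpolation is at most a slope times the step, and the slopes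
on [0, M] are at most the increment of [f2] over [M, M + 1]. *)
Let truncation_approx (M e : R) : 0 < M -> 0 < e -> exists l : seq (R * R),
  (forall ct, ct \in l -> 0 <= ct.1 /\ 0 <= ct.2) /\
  forall x, 0 <= x <= M -> `|f2 x - (f2 0 + hinge l x)| <= e.
Proof.
move=> M0 e0; pose L := f2 (M + 1) - f2 M.
have L0 : 0 <= L.
  by rewrite subr_ge0; apply: (C2up_derive2_nondecreasing fup); rewrite ?(ltW M0)// lerDl.
have X0 : 0 <= M + L * M / e by rewrite addr_ge0// ?divr_ge0// ?mulr_ge0// ltW.
pose N := Num.bound (M + L * M / e).
have XN : M + L * M / e < N%:R by exact: archi_boundP.
have N0 : 0 < N%:R :> R by exact: le_lt_trans XN.
pose d := M / N%:R.
have d0 : 0 < d by rewrite divr_gt0.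
have Nd : N%:R * d = M by rewrite /d mulrC divfK// gt_eqF.
have d1 : d <= 1.
  rewrite ler_pdivrMr// mul1r; apply/ltW/(le_lt_trans _ XN).
  by rewrite lerDl divr_ge0// ?mulr_ge0// ltW.
have [l [sg [_ _ l0] [_ lM]]] := grid_approx N d0.
exists l; split => // x; rewrite -Nd => /lM /le_trans; apply.
have sL : slope d N <= L.
  rewrite ler_pdivrMr// -natr1 mulrDl Nd mul1r.
  have [_ _ _ cf _] := fup.
  have h : 0 <= d <= 1 by rewrite (ltW d0).
  have := cf _ (M + 1) M h.
  rewrite (_ : _ * _ + _ = M + d); last by ring.
  by rewrite /L; lra.
apply: (le_trans (ler_wpM2r (ltW d0) sL)).
rewrite /d mulrA ler_pdivrMr// mulrC -ler_pdivrMl// [_^-1 * _]mulrC.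
by apply/ltW/(le_lt_trans _ XN); rewrite [M * L]mulrC lerDr ltW.
Qed.

(** The inequality of convexity only involves points in a bounded set, where
[f2] can be replaced by its approximation [k] and [f1] by the primitive [F] of
[k]. *)
Let lift2_convex : convexR (lift2 f2 f1).
Proof.
move=> s x y s01; apply/ler_addgt0Pr => e e0.
set z := s * x + (1 - s) * y.
pose M := w x + w y + w z.
have M0 : 0 < M by rewrite !addr_gt0.
pose C := 2 * (1 + M / p).
have C0 : 0 < C by rewrite mulr_gt0// ltr_pwDl// divr_ge0// ltW.
have [l [l0 lM]] := truncation_approx M0 (divr_gt0 e0 C0).
pose k u := f2 0 + hinge l u.
pose F u := f2 0 * u + hinge_int l u.
have dF (u : R) : is_derive u 1 F (k u).
  by apply: (is_derive_eq (derD (derM (der_cst (f2 0) u) (der_id u))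
    (is_derive_hinge_int l u))); rewrite /k; ring.
have F0 : F 0 = 0.
  rewrite /F mulr0 add0r /hinge_int big_seq big1// => ct /l0[_ t0].
  by rewrite sub0r max_r ?oppr_le0// expr0n/= !(mul0r, mulr0).
have kM u : 0 <= u <= M -> `|f2 u - k u| <= e / C by exact: lM.
have FM u : 0 <= u <= M -> `|f1 u - F u| <= e / C * M.
  move=> /andP[]; rewrite le_eqVlt => /orP[/eqP<- _|u0 uM].
    by rewrite (C2up_derive0 fup) F0 subrr normr0 mulr_ge0 ?divr_ge0 ?(ltW e0) ?(ltW C0)
      ?(ltW M0).
  have [_ _ ddf _ _] := fup.
  have dG (v : R) : is_derive v 1 (fun v => f1 v - F v) (f2 v - k v).
    exact: derD (ddf v) (derN (dF v)).
  have [c /andP[c0 cu] cE] := MVT_everywhere dG u0.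
  have -> : f1 u - F u = (f2 c - k c) * u.
    by move: cE; rewrite (C2up_derive0 fup) F0 !subr0.
  rewrite normrM (gtr0_norm u0) ler_pM// ?(ltW u0)// kM// (ltW c0)/=.
  exact/ltW/(lt_le_trans cu).
have close v : w v <= M -> `|lift2 f2 f1 v - lift2 k F v| <= e / 2.
  move=> vM; have wv : 0 <= w v <= M by rewrite ltW.
  have -> : lift2 f2 f1 v - lift2 k F v = (f2 (w v) - k (w v)) * (v ^+ 2 / w v ^+ 2)
     + (f1 (w v) - F (w v)) * (p ^+ 2 / w v ^+ 3) by rewrite /lift2; ring.
  have h1 : v ^+ 2 / w v ^+ 2 <= 1.
    by rewrite ler_pdivrMr ?exprn_gt0// mul1r w_sqr lerDr sqr_ge0.
  have h2 : p ^+ 2 / w v ^+ 3 <= p^-1.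
    rewrite ler_pdivrMr ?exprn_gt0// ler_pdivlMl// -exprS.
    by rewrite ler_pXn2r ?nnegrE ?(ltW p0) ?(ltW (w_gt0 v)).
  have h1' : 0 <= v ^+ 2 / w v ^+ 2 by rewrite divr_ge0 ?sqr_ge0.
  have h2' : 0 <= p ^+ 2 / w v ^+ 3 by rewrite divr_ge0 ?sqr_ge0// exprn_ge0// ltW.
  apply: (le_trans (ler_normD _ _));
    rewrite [X in X + _]normrM [X in _ + X]normrM (ger0_norm h1') (ger0_norm h2').
  apply: (@le_trans _ _ (e / C * 1 + e / C * M * p^-1)).
    by apply: lerD; apply: ler_pM => //; [exact: kM|exact: FM].
  rewrite le_eqVlt; apply/orP; left; apply/eqP.
  have pM : p + M != 0 by rewrite gt_eqF// addr_gt0.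
  by rewrite /C; field; rewrite pM (gt_eqF p0).
have kFE v : lift2 k F v = f2 0 + lift2 (hinge l) (hinge_int l) v.
  rewrite /lift2 /k /F.
  have -> : v ^+ 2 = w v ^+ 2 - p ^+ 2 by rewrite w_sqr addrAC subrr add0r.
  by field.
have wxM : w x <= M by rewrite /M -addrA lerDl addr_ge0// ltW.
have wyM : w y <= M by rewrite /M addrAC lerDr addr_ge0// ltW.
have wzM : w z <= M by rewrite /M lerDr addr_ge0// ltW.
have := hinge_convex l0 x y s01; rewrite -/z => hc.
have [s0 s1] := andP s01.
have := close _ wxM; rewrite ler_norml kFE => /andP[xl _].
have := close _ wyM; rewrite ler_norml kFE => /andP[yl _].
have := close _ wzM; rewrite ler_norml kFE => /andP[_ zu].
have s1' : 0 <= 1 - s by rewrite subr_ge0.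
have := ler_wpM2l s0 xl; have := ler_wpM2l s1' yl.
rewrite !mulrDr.
set Lx := lift2 _ _ x in hc *. set Ly := lift2 _ _ y in hc *.
by move: hc zu; lra.
Qed.

(** A radial function built on the class restricts to a function of the class on
each line, [p] being the distance of the line to the origin. *)
Lemma C2up_sqrt : exists g1 g2, C2up (fun z => f (Num.sqrt (p ^+ 2 + z ^+ 2))) g1 g2.
Proof.
have [fN df ddf cf [f0 f20]] := fup.
have Df z : is_derive z 1 (fun z => f (w z)) (f1 (w z) * (z * (w z)^-1)).
  exact: (der_comp (df _) (is_derive_w z)).
exists (fun z => f1 (w z) * (z * (w z)^-1)), (lift2 f2 f1); split => //.
- by move=> x; rewrite sqrrN.
- move=> z; have D := derV (w_neq0 z) (is_derive_w z).
  apply: (is_derive_eq (derM (der_comp (ddf _) (is_derive_w z)) (derM (der_id z) D))).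
  rewrite /lift2; have -> : p ^+ 2 = w z ^+ 2 - z ^+ 2 by rewrite w_sqr addrK.
  by field.
- split; first exact: (C2up_ge0 fup).
  rewrite /lift2 expr0n/= mul0r mulr0 add0r mulr_ge0//.
    rewrite -(C2up_derive0 fup); apply: (C2up_derive_nondecreasing fup).
    exact: sqrtr_ge0.
  by rewrite divr_ge0 ?sqr_ge0// exprn_ge0// sqrtr_ge0.
Qed.

End lift.

(** * Integrals and densities *)

(** Here [nu] is the image under [X] of the measure of density [w] with respect
to [mu]. *)
Section density.
Local Open Scope ereal_scope.
Context d d' (T : measurableType d) (T' : measurableType d') (R : realType).
Variables (mu : {measure set T -> \bar R}) (nu : {measure set T' -> \bar R}).
Variables (X : T -> T') (w : T -> R).
Hypotheses (mX : measurable_fun setT X) (mw : measurable_fun setT w).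
Hypothesis w0 : forall x, (0 <= w x)%R.
Hypothesis nuE : forall A, measurable A ->
  nu A = \int[mu]_x (w x * \1_A (X x))%:E.

Import HBNNSimple.

Let density_nnsfun (h : {nnsfun T' >-> R}) :
  \int[nu]_y (h y)%:E = \int[mu]_x ((h (X x))%:E * (w x)%:E).
Proof.
have mpre (r : R) : measurable (h @^-1` [set r]) by [].
have mind (r : R) : measurable_fun setT (fun x => (\1_(h @^-1` [set r]) (X x))%:E : \bar R).
  by apply/measurable_EFinP; apply: measurableT_comp.
transitivity (\sum_(r \in range h) (r%:E * nu (h @^-1` [set r]))).
  under eq_integral do rewrite fimfunE -fsumEFin//.
  rewrite ge0_integral_fsum//; last 2 first.
  - by move=> y; exact/measurable_EFinP/measurable_funM.
  - by move=> y x _; rewrite nnfun_muleindic_ge0.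
  by apply: eq_fsbigr => r _; rewrite integralZl_indic_nnsfun// integral_indic// setIT.
transitivity (\sum_(r \in range h)
    \int[mu]_x ((r * \1_(h @^-1` [set r]) (X x))%:E * (w x)%:E)).
  apply: eq_fsbigr => r; rewrite inE => -[y _ <-{r}].
  rewrite nuE// -ge0_integralZl//.
  - by apply: eq_integral => x _; rewrite -!EFinM mulrA mulrAC.
  - by apply/measurable_EFinP/measurable_funM => //; apply: measurableT_comp.
  - by move=> x _; rewrite lee_fin mulr_ge0.
  - by rewrite lee_fin.
rewrite -ge0_integral_fsum//.
- apply: eq_integral => x _; rewrite [in RHS]fimfunE -[in RHS]fsumEFin//.
  rewrite ge0_mule_fsuml// => r.
  exact: (nnfun_muleindic_ge0 h).
- move=> r; apply: emeasurable_funM; last exact/measurable_EFinP.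
  under eq_fun do rewrite EFinM.
  exact: emeasurable_funM.
- move=> r x _; rewrite mule_ge0// ?lee_fin//.
  exact: (nnfun_muleindic_ge0 h).
Qed.

(** The hypothesis on sets extends to simple functions by linearity, then to
nonnegative functions by monotone convergence. *)
Lemma ge0_integral_density (f : T' -> \bar R) :
  measurable_fun setT f -> (forall y, 0 <= f y) ->
  \int[nu]_y f y = \int[mu]_x (f (X x) * (w x)%:E).
Proof.
move=> mf f0; pose h := nnsfun_approx measurableT mf.
have mhw n : measurable_fun setT (fun x => (h n (X x))%:E * (w x)%:E).
  by apply: emeasurable_funM; apply/measurable_EFinP => //; exact: measurableT_comp.
transitivity (limn (fun n => \int[nu]_y (h n y)%:E)).
  rewrite -monotone_convergence//.
  - apply: eq_integral => y _; apply/esym/cvg_lim => //.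
    exact: cvg_nnsfun_approx.
  - by move=> n; exact/measurable_EFinP.
  - by move=> n y _; rewrite lee_fin.
  - by move=> y _ m n mn; rewrite lee_fin; exact/lefP/nd_nnsfun_approx.
rewrite [X in limn X](_ : _ = fun n => \int[mu]_x ((h n (X x))%:E * (w x)%:E)); last first.
  by apply/funext => n; exact: density_nnsfun.
rewrite -monotone_convergence//.
- apply: eq_integral => x _; apply/cvg_lim => //.
  by apply: cvgeZr => //; exact: cvg_nnsfun_approx.
- by move=> n x _; rewrite mule_ge0 ?lee_fin.
- move=> x _ m n mn; rewrite lee_wpmul2r ?lee_fin//.
  exact/lefP/nd_nnsfun_approx.
Qed.

End density.

(** * Affine substitutions and the Gaussian density *)

Section affine_substitution.
Context {R : realType}.
Local Notation mR := (measurableTypeR R).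
Local Notation leb := (@lebesgue_measure R).
Implicit Types a b : R.

Definition affine a b (x : mR) : mR := a + b * x.

Lemma measurable_affine a b : measurable_fun setT (affine a b).
Proof.
by apply: (@measurable_funD _ _ R) => //; apply: (@measurable_funM _ _ R).
Qed.

(** Both sides are measures of [A] that agree on intervals. *)
Lemma lebesgue_measure_affine a b (A : set mR) : 0 < b -> measurable A ->
  leb A = (b%:E * leb (affine a b @^-1` A))%E.
Proof.
move=> b0 mA.
pose m := mscale (NngNum (ltW b0)) (pushforward leb (affine a b)).
apply: (@lebesgue_measure_unique R (m (measurable_affine a b))) => // _ [[l u]] _ <-/=.
rewrite /m /mscale/= /pushforward.
have -> : affine a b @^-1` `]l, u] = `](l - a) / b, (u - a) / b]%classic.
  apply/seteqP; split=> x /=; rewrite !in_itv/= /affine ltr_pdivrMr// ler_pdivlMr//;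
  by rewrite ltrBlDl lerBrDl mulrC.
rewrite !lebesgue_measure_itv/= !lte_fin ltr_pM2r ?invr_gt0// ltrD2r.
case: ifPn => _; last by rewrite mule0.
rewrite -!EFinD -EFinM; congr EFin; field.
by rewrite gt_eqF.
Qed.

Lemma ge0_integral_affine (f : R -> \bar R) a b : 0 < b ->
  measurable_fun setT f -> (forall x, 0 <= f x)%E ->
  (\int[leb]_x f x = b%:E * \int[leb]_x f (a + b * x)%R)%E.
Proof.
move=> b0 mf f0.
rewrite (@ge0_integral_density _ _ mR mR R leb leb (affine a b) (fun=> b))//=.
- rewrite -ge0_integralZl//; [|by apply: measurableT_comp => //;
    exact: measurable_affine|by rewrite lee_fin ltW].
  by apply: eq_integral => x _; rewrite muleC.
- exact: measurable_affine.
- by move=> _; exact: ltW.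
- move=> A mA; have mB : measurable (affine a b @^-1` A).
    by rewrite -[X in measurable X]setTI; exact: measurable_affine.
  rewrite (lebesgue_measure_affine a b0 mA).
  have := integral_indic leb measurableT mB; rewrite setIT => <-.
  rewrite -ge0_integralZl_EFin// ?ltW//.
  exact/measurable_EFinP.
Qed.

Lemma ge0_integral_oppr (f : R -> \bar R) :
  measurable_fun setT f -> (forall x, 0 <= f x)%E ->
  (\int[leb]_x f x = \int[leb]_x f (- x)%R)%E.
Proof.
move=> mf f0.
rewrite -[RHS](@ge0_integral_pushforward _ _ mR mR R -%R _ leb setT f)//.
by apply: eq_measure_integral => A mA _; exact/esym/lebesgue_measureN.
Qed.

End affine_substitution.

Section gauss.
Context {R : realType}.
Local Notation mR := (measurableTypeR R).
Local Notation leb := (@lebesgue_measure R).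
Local Notation gamma := (@normal_prob R 0 1).

Definition gauss_pdf (x : R) : R := normal_peak 1 * expR (- (x ^+ 2 / 2)).

Lemma gauss_pdfE : normal_pdf (0 : R) 1 = gauss_pdf.
Proof.
apply/funext => x; rewrite /normal_pdf oner_eq0 /normal_fun.
by rewrite subr0 expr1n mulNr.
Qed.

Lemma gauss_pdf_ge0 x : 0 <= gauss_pdf x.
Proof. by rewrite -gauss_pdfE normal_pdf_ge0. Qed.

Lemma measurable_gauss_pdf : measurable_fun setT gauss_pdf.
Proof. by rewrite -gauss_pdfE; exact: measurable_normal_pdf. Qed.

Lemma gauss_pdf_oppr x : gauss_pdf (- x) = gauss_pdf x.
Proof. by rewrite /gauss_pdf sqrrN. Qed.

Lemma gauss_pdf_rotation x y x' y' : x ^+ 2 + y ^+ 2 = x' ^+ 2 + y' ^+ 2 ->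
  gauss_pdf x * gauss_pdf y = gauss_pdf x' * gauss_pdf y'.
Proof.
move=> h; rewrite /gauss_pdf mulrACA [RHS]mulrACA -!expRD; congr (_ * expR _); lra.
Qed.

Lemma integral_gauss (f : R -> \bar R) :
  measurable_fun setT f -> (forall x, 0 <= f x)%E ->
  (\int[gamma]_x f x = \int[leb]_x (f x * (gauss_pdf x)%:E))%E.
Proof.
move=> mf f0; apply: (@ge0_integral_density _ _ mR mR R leb gamma idfun) => //.
- exact: measurable_id.
- exact: measurable_gauss_pdf.
- exact: gauss_pdf_ge0.
move=> A mA; rewrite [LHS](_ : _ = \int[leb]_(x in A) (gauss_pdf x)%:E)%E;
  last by rewrite -gauss_pdfE.
rewrite [LHS]integral_mkcond/=.
apply: eq_integral => x _; rewrite patchE indicE.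
by case: (x \in A); rewrite ?mulr1 ?mulr0.
Qed.

Lemma integral_gauss_oppr (f : R -> \bar R) :
  measurable_fun setT f -> (forall x, 0 <= f x)%E ->
  (\int[gamma]_x f (- x)%R = \int[gamma]_x f x)%E.
Proof.
move=> mf f0.
have mfN : measurable_fun setT (fun x : R => f (- x)).
  exact: (measurableT_comp mf (@oppr_measurable R setT)).
rewrite integral_gauss// integral_gauss// [RHS]ge0_integral_oppr.
- by apply: eq_integral => x _; rewrite gauss_pdf_oppr.
- by apply: emeasurable_funM => //; apply/measurable_EFinP; exact: measurable_gauss_pdf.
- by move=> x; rewrite mule_ge0// lee_fin gauss_pdf_ge0.
Qed.

End gauss.

(** * Rotation invariance of the plane Gaussian law *)

Section sections_measurability.
Context d1 d2 (T1 : measurableType d1) (T2 : measurableType d2) (R : realType).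
Variable f : T1 * T2 -> \bar R.
Hypothesis mf : measurable_fun setT f.

Lemma measurable_pair_r x : measurable_fun setT (fun y => f (x, y)).
Proof. exact: (measurableT_comp mf (measurable_fun_pair (measurable_cst x)
  (@measurable_id _ _ setT))). Qed.

Lemma measurable_pair_l y : measurable_fun setT (fun x => f (x, y)).
Proof. exact: (measurableT_comp mf (measurable_fun_pair (@measurable_id _ _ setT)
  (measurable_cst y))). Qed.

End sections_measurability.

Section rotation.
Context {R : realType}.
Local Notation mR := (measurableTypeR R).
Local Notation leb := (@lebesgue_measure R).
Local Notation gamma := (@normal_prob R 0 1).
Local Open Scope ereal_scope.
Variables a b : R.
Hypotheses (b0 : (0 < b)%R) (ab1 : (a ^+ 2 + b ^+ 2 = 1)%R).

Let rot (z : mR * mR) : mR * mR := (a * z.1 - b * z.2, b * z.1 + a * z.2)%R.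

Let measurable_rot : measurable_fun setT rot.
Proof.
apply: measurable_fun_pair.
  by apply: (@measurable_funB _ _ R); apply: (@measurable_funM _ _ R).
by apply: (@measurable_funD _ _ R); apply: (@measurable_funM _ _ R).
Qed.

Section lebesgue.
Variable K : mR * mR -> \bar R.
Hypotheses (mK : measurable_fun setT K) (K0 : forall z, 0 <= K z).
Let tonelli (F : mR * mR -> \bar R) : measurable_fun setT F -> (forall z, 0 <= F z) ->
  \int[leb]_x \int[leb]_y F (x, y) = \int[leb]_y \int[leb]_x F (x, y).
Proof. by move=> mF F0; exact: (@fubini_tonelli _ _ mR mR R leb leb F). Qed.

(** The plane Lebesgue measure is invariant under rotation: a rotation is two
one-dimensional affine substitutions. *)
Lemma lebesgue_rotation :
  \int[leb]_x \int[leb]_y K (rot (x, y)) = \int[leb]_x \int[leb]_y K (x, y).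
Proof.
have b_neq0 : b != 0%R by rewrite gt_eqF.
have mKr : measurable_fun setT (K \o rot) by exact: measurableT_comp.
(* first substitution: t = b x + a y for fixed y *)
pose S (z : mR * mR) : mR * mR := ((a * z.2 - z.1) / b, z.2)%R.
have mS : measurable_fun setT S.
  apply: measurable_fun_pair => //.
  apply: (@measurable_funM _ _ R) => //.
  by apply: (@measurable_funB _ _ R) => //; apply: (@measurable_funM _ _ R).
have mKS : measurable_fun setT (K \o S) by exact: measurableT_comp.
have b1 : (0 < b^-1)%R by rewrite invr_gt0.
transitivity (\int[leb]_y \int[leb]_t (b^-1%:E * (K \o S) (y, t))).
  rewrite (tonelli mKr (fun z => K0 (rot z))).
  apply: eq_integral => y _.
  rewrite (@ge0_integral_affine R (fun x => (K \o rot) (x, y)) (- (a * y) / b) b^-1 b1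
    (measurable_pair_l mKr y) (fun x => K0 _)).
  rewrite -(ge0_integralZl_EFin leb measurableT (fun x _ => K0 _) _ (ltW b1)); last first.
    apply: (measurableT_comp (measurable_pair_l mKr y)).
    exact: measurable_affine.
  apply: eq_integral => t _; congr (_ * K _).
  rewrite /rot /S/=; congr pair.
    apply: (mulIf b_neq0); rewrite divfK// mulrBl.
    have -> : (a * (- (a * y) / b + b^-1 * t) * b = - a ^+ 2 * y + a * t)%R by field.
    have -> : (a ^+ 2 = 1 - b ^+ 2)%R by rewrite -ab1 addrK.
    by ring.
  by field.
(* second substitution: y = a t - b s for fixed t *)
have bKS0 z : 0 <= b^-1%:E * (K \o S) z by apply: mule_ge0; [rewrite lee_fin ltW|exact: K0].
rewrite (tonelli (measurable_funeM b^-1%:E mKS) bKS0) [RHS](tonelli mK K0).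
apply: eq_integral => t _.
rewrite ge0_integral_oppr; last 2 first.
- by apply: measurable_funeM; exact: (measurable_pair_l mKS t).
- by move=> z; exact: bKS0.
have mKN : measurable_fun setT (fun y : mR => b^-1%:E * (K \o S) (- y, t)%R).
  apply: measurable_funeM; apply: (measurableT_comp (measurable_pair_l mKS t)).
  exact: oppr_measurable.
rewrite (@ge0_integral_affine R _ (- (a * t)) b b0 mKN (fun z => bKS0 _)).
rewrite -(ge0_integralZl_EFin leb measurableT (fun z _ => bKS0 _) _ (ltW b0)); last first.
  exact: (measurableT_comp mKN (measurable_affine _ _)).
apply: eq_integral => s _.
rewrite muleA -EFinM divff// mul1e /S/=; congr (K (_, _)).
by field.
Qed.

End lebesgue.

Let pdf2 (z : mR * mR) : R := (gauss_pdf z.1 * gauss_pdf z.2)%R.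

Let measurable_pdf2 : measurable_fun setT pdf2.
Proof.
apply: measurable_funM; apply: measurableT_comp => //; exact: measurable_gauss_pdf.
Qed.

Let pdf2_ge0 z : (0 <= pdf2 z)%R.
Proof. by rewrite mulr_ge0// gauss_pdf_ge0. Qed.

Let integral_gauss2 (H : mR * mR -> \bar R) :
  measurable_fun setT H -> (forall z, 0 <= H z) ->
  \int[gamma]_x \int[gamma]_y H (x, y) =
  \int[leb]_x \int[leb]_y (H (x, y) * (pdf2 (x, y))%:E).
Proof.
move=> mH H0; rewrite (@integral_gauss R (fun x => \int[gamma]_y H (x, y))).
- apply: eq_integral => x _; rewrite (@integral_gauss R (fun y => H (x, y)))//;
    last exact: measurable_pair_r.
  rewrite -ge0_integralZr//.
  + by apply: eq_integral => y _; rewrite -muleA -EFinM mulrC.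
  + by apply: emeasurable_funM; [exact: measurable_pair_r|by apply/measurable_EFinP;
      exact: measurable_gauss_pdf].
  + by move=> y _; rewrite mule_ge0// lee_fin gauss_pdf_ge0.
  + by rewrite lee_fin gauss_pdf_ge0.
- exact: (@measurable_fun_fubini_tonelli_F _ _ mR mR R gamma H).
- by move=> x; apply: integral_ge0.
Qed.

(** The density with respect to the plane Lebesgue measure only depends on the
distance to the origin. *)
Lemma gauss_rotation (H : mR * mR -> \bar R) :
  measurable_fun setT H -> (forall z, 0 <= H z) ->
  \int[gamma]_x \int[gamma]_y H (a * x - b * y, b * x + a * y)%R =
  \int[gamma]_x \int[gamma]_y H (x, y).
Proof.
move=> mH H0.
rewrite (integral_gauss2 (measurableT_comp mH measurable_rot) (fun z => H0 _)).
rewrite (integral_gauss2 mH H0).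
have mK : measurable_fun setT (fun z => H z * (pdf2 z)%:E).
  by apply: emeasurable_funM => //; exact/measurable_EFinP.
have K0 z : 0 <= H z * (pdf2 z)%:E by rewrite mule_ge0// lee_fin.
rewrite -(lebesgue_rotation mK K0).
apply: eq_integral => x _; apply: eq_integral => y _ /=; congr (_ * _%:E).
apply: gauss_pdf_rotation => /=.
transitivity ((a ^+ 2 + b ^+ 2) * (x ^+ 2 + y ^+ 2))%R; last by ring.
by rewrite ab1 mul1r.
Qed.

End rotation.

(** * Gaussian sums *)

Section gauss_sum.
Context {R : realType} {n : nat}.
Local Notation mR := (measurableTypeR R).
Local Notation gamma := (@normal_prob R 0 1).
Local Notation V := 'cV[R]_n.
Implicit Types (a b : V) (s : seq V) (phi : mR -> \bar R).

Definition normsq b : R := \sum_i b i 0 ^+ 2.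

(** The expectation of [phi (normsq (b + \sum_(a <- s) g_a *: a))] for
independent standard normal [g_a], as an iterated integral. *)
Fixpoint gauss_mean phi s b : \bar R :=
  if s is a :: s' then (\int[gamma]_t gauss_mean phi s' (b + t *: a)%R)%E
  else phi (normsq b).

Lemma gauss_mean_ge0 phi s b : (forall x, 0 <= phi x)%E -> (0 <= gauss_mean phi s b)%E.
Proof.
by move=> phi0; elim: s b => [|a s IH] b //=; apply: integral_ge0 => t _.
Qed.

Lemma measurable_gauss_mean phi s d (X : measurableType d) (B : X -> V) :
  measurable_fun setT phi -> (forall x, 0 <= phi x)%E ->
  (forall i, measurable_fun setT (fun x => B x i 0 : mR)) ->
  measurable_fun setT (fun x => gauss_mean phi s (B x)).
Proof.
move=> mphi phi0; elim: s d X B => [|a s IH] d X B mB /=.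
  apply: measurableT_comp => //; rewrite /normsq.
  by apply: (@measurable_sum _ X R) => i; apply: (@measurable_funX _ X R); exact: mB.
pose f (z : X * mR) := gauss_mean phi s (B z.1 + z.2 *: a).
have mf : measurable_fun setT f.
  apply: IH => i.
  under eq_fun do rewrite !mxE.
  apply: (@measurable_funD _ _ R).
    exact: (measurableT_comp (mB i)).
  by apply: (@measurable_funM _ _ R).
apply: (@measurable_fun_fubini_tonelli_F _ _ X mR R gamma f mf).
by move=> z; exact: gauss_mean_ge0.
Qed.

Section fixed_phi.
Variable phi : mR -> \bar R.
Hypotheses (mphi : measurable_fun setT phi) (phi0 : forall x, (0 <= phi x)%E).
Local Notation J := (gauss_mean phi).

(** The two leading vectors may be rotated into each other, since the law of their
pair of coefficients is rotation invariant. *)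
Lemma gauss_mean_rotate a1 a2 s b (p q : R) : 0 < q -> p ^+ 2 + q ^+ 2 = 1 ->
  J [:: a1, a2 & s] b = J [:: p *: a1 + q *: a2, p *: a2 - q *: a1 & s] b.
Proof.
move=> q0 pq1 /=.
pose H (z : mR * mR) := J s (b + z.1 *: a1 + z.2 *: a2).
have mH : measurable_fun setT H.
  apply: measurable_gauss_mean => // i.
  under eq_fun do rewrite !mxE.
  by apply: (@measurable_funD _ _ R); [apply: (@measurable_funD _ _ R) => //|];
    apply: (@measurable_funM _ _ R).
have H0 z : (0 <= H z)%E by exact: gauss_mean_ge0.
rewrite -[LHS](gauss_rotation q0 pq1 mH H0).
apply: eq_integral => x _; apply: eq_integral => y _; rewrite /H/=; congr (J s _).
by apply/colP => i; rewrite !mxE; ring.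
Qed.

Definition gram s : 'M[R]_n := \sum_(a <- s) a *m a^T.

Lemma gram_cons a s : gram (a :: s) = a *m a^T + gram s.
Proof. by rewrite /gram big_cons. Qed.

Lemma gramE s i j : gram s i j = \sum_(a <- s) a i 0 * a j 0.
Proof.
rewrite /gram summxE; apply: eq_bigr => a _.
by rewrite mxE big_ord1 mxE.
Qed.

(** Givens rotations bring all the [i]-th coordinates to the head vector. They
preserve the mean and the Gram matrix, that is, the covariance of the Gaussian
sum. *)
Lemma gauss_mean_align s a i : exists a' s', [/\
  size s' = size s, (forall c, c \in s' -> c i 0 = 0),
  gram (a' :: s') = gram (a :: s) & forall b, J (a' :: s') b = J (a :: s) b].
Proof.
elim: s a => [|a2 s IH] a; first by exists a, [::]; split.
have [a2' [s' [sz s'0 gE JE]]] := IH a2.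
have step a'' b'' : gram [:: a'', b'' & s'] = gram [:: a, a2' & s'] ->
    (forall b, J [:: a'', b'' & s'] b = J [:: a, a2' & s'] b) -> b'' i 0 = 0 ->
    exists a' s', [/\ size s' = (size s).+1, (forall c, c \in s' -> c i 0 = 0),
      gram (a' :: s') = gram [:: a, a2 & s] & forall b, J (a' :: s') b = J [:: a, a2 & s] b].
  move=> gE' JE' b0; exists a'', (b'' :: s'); split.
  - by rewrite /= sz.
  - by move=> c; rewrite inE => /orP[/eqP->//|/s'0].
  - by rewrite gE' gram_cons gE -gram_cons.
  - by move=> b; rewrite JE' /=; apply: eq_integral => t _; exact: JE.
have [a20|a20] := eqVneq (a2' i 0) 0; first exact: (step a a2').
pose rho := Num.sqrt (a i 0 ^+ 2 + a2' i 0 ^+ 2).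
have r0 : 0 < a i 0 ^+ 2 + a2' i 0 ^+ 2 by rewrite ltr_wpDl ?sqr_ge0// exprn_even_gt0.
have rho0 : 0 < rho by rewrite sqrtr_gt0.
have rho_neq0 : rho != 0 by rewrite gt_eqF.
have rho2 : rho ^+ 2 = a i 0 ^+ 2 + a2' i 0 ^+ 2 by rewrite sqr_sqrtr// ltW.
(* the sign makes the second coefficient of the rotation positive *)
pose sg := Num.sg (a2' i 0).
have sg2 : sg ^+ 2 = 1 by rewrite sqr_sg a20.
pose p := sg * a i 0 / rho; pose q := sg * a2' i 0 / rho.
have q0 : 0 < q by rewrite divr_gt0// /sg -normrEsg normr_gt0.
have pq1 : p ^+ 2 + q ^+ 2 = 1.
  rewrite /p /q !exprMn sg2 !mul1r -mulrDl -rho2 exprVn divff//.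
  by rewrite expf_neq0.
apply: (step (p *: a + q *: a2') (p *: a2' - q *: a)).
- rewrite !gram_cons !addrA; congr (_ + _).
  apply/matrixP => j k; rewrite !mxE !big_ord1 !mxE.
  transitivity ((p ^+ 2 + q ^+ 2) * (a j 0 * a k 0 + a2' j 0 * a2' k 0)); first by ring.
  by rewrite pq1 mul1r.
- by move=> b; rewrite -gauss_mean_rotate.
- by rewrite !mxE /p /q; ring.
Qed.

End fixed_phi.

Lemma gauss_mean0 phi s b : (forall a, a \in s -> a = 0) ->
  gauss_mean phi s b = phi (normsq b).
Proof.
elim: s b => [//|a s IH] b s0 /=.
rewrite (s0 a (mem_head _ _)) [RHS](_ : _ = \int[gamma]_t (cst (phi (normsq b)) t))%E;
  last first.
  by rewrite integral_cst// [X in (_ * X)%E]probability_setT mule1.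
apply: eq_integral => t _; rewrite scaler0 addr0; apply: IH => c cs.
by apply: s0; rewrite inE cs orbT.
Qed.

(** Pythagoras: a shift orthogonal to the Gaussian sum adds its squared norm. *)
Lemma gauss_mean_orthogonal phi s a b : (forall c, c \in s -> \sum_i a i 0 * c i 0 = 0) ->
  \sum_i a i 0 * b i 0 = 0 ->
  gauss_mean phi s (a + b) = gauss_mean (fun y => phi (normsq a + y)) s b.
Proof.
elim: s b => [|c s IH] b ort ab /=.
  congr phi; rewrite /normsq -big_split/=.
  have -> : \sum_i (a + b) i 0 ^+ 2 =
     \sum_i (a i 0 ^+ 2 + b i 0 ^+ 2) + (\sum_i a i 0 * b i 0) *+ 2.
    rewrite -mulr_natr mulr_suml -big_split/=; apply: eq_bigr => i _.
    by rewrite mxE; ring.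
  by rewrite ab mul0rn addr0.
apply: eq_integral => t _; rewrite -addrA IH//.
  by move=> e es; apply: ort; rewrite inE es orbT.
rewrite (_ : \sum_i _ = \sum_i a i 0 * b i 0 + t * \sum_i a i 0 * c i 0).
  by rewrite ab ort ?mem_head// mulr0 addr0.
by rewrite mulr_sumr -big_split/=; apply: eq_bigr => i _; rewrite !mxE; ring.
Qed.

End gauss_sum.

(** * The chi-square law of a projected Gaussian vector *)

Section chi_square.
Context {R : realType}.
Local Notation mR := (measurableTypeR R).
Local Notation gamma := (@normal_prob R 0 1).
Implicit Types phi : mR -> \bar R.

Lemma integral_chi_square0 phi : measurable_fun setT phi ->
  (\int[chi_square_prob 0]_y phi y = phi 0%R)%E.
Proof. by move=> mphi; rewrite /= integral_dirac// diracT mul1e. Qed.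

Lemma integral_chi_squareS k phi : measurable_fun setT phi ->
  (forall y, 0 <= phi y)%E ->
  (\int[chi_square_prob k.+1]_y phi y =
   \int[gamma]_z \int[chi_square_prob k]_x phi (x + z ^+ 2)%R)%E.
Proof.
move=> mphi phi0.
rewrite [LHS](@ge0_integral_distribution _ _ _ _ _ (chi_square_prob k \x gamma)%E
  (@add_sqr R) phi)//.
apply: (@fubini_tonelli2 _ _ mR mR R (chi_square_prob k) gamma (fun z => phi
  (add_sqr z))) => //.
exact: (measurableT_comp mphi (@measurable_add_sqr R)).
Qed.

Section projector.
Context {n : nat}.
Implicit Types (a b : 'cV[R]_n) (s : seq 'cV[R]_n).

Lemma trace_gram s : \tr (gram s) = \sum_(a <- s) normsq a.
Proof.
rewrite /mxtrace /normsq exchange_big/=; apply: eq_bigr => i _.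
by rewrite gramE; apply: eq_bigr => a _; rewrite expr2.
Qed.

Lemma normsq_ge0 b : 0 <= normsq b.
Proof. by apply: sumr_ge0 => i _; exact: sqr_ge0. Qed.

Lemma normsq_eq0 b : normsq b = 0 -> b = 0.
Proof.
move=> /eqP; rewrite /normsq psumr_eq0 => [/allP b0|i _]; last exact: sqr_ge0.
apply/colP => i; rewrite mxE; apply/eqP; rewrite -sqrf_eq0.
by have := b0 i; rewrite mem_index_enum => /(_ isT).
Qed.

Lemma normsqZ (t : R) b : normsq (t *: b) = t ^+ 2 * normsq b.
Proof. by rewrite /normsq mulr_sumr; apply: eq_bigr => i _; rewrite mxE exprMn. Qed.

Lemma dotE a b : (a^T *m b) 0 0 = \sum_i a i 0 * b i 0.
Proof. by rewrite mxE; apply: eq_bigr => i _; rewrite mxE. Qed.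

(** If the Gram matrix of an aligned system is a projector, then its first
vector is a unit vector of the range, orthogonal to the other ones. *)
Lemma aligned_projector a s i : gram (a :: s) *m gram (a :: s) = gram (a :: s) ->
  (forall c, c \in s -> c i 0 = 0) -> gram (a :: s) i i != 0 ->
  [/\ normsq a = 1, forall c, c \in s -> \sum_i a i 0 * c i 0 = 0 &
      gram s *m gram s = gram s].
Proof.
move=> idem s0 Gii.
have rowi j : gram s j i = 0.
  by rewrite gramE big_seq big1// => c /s0 ->; rewrite mulr0.
have coli j : gram s i j = 0.
  by rewrite gramE big_seq big1// => c /s0 ->; rewrite mul0r.
have ai0 : a i 0 != 0.
  apply: contraNN Gii => /eqP ai; rewrite gram_cons mxE coli addr0 mxE big_ord1 mxE.
  by rewrite ai mul0r.
have Gcol : col i (gram (a :: s)) = a i 0 *: a.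
  by apply/colP => j; rewrite !mxE gram_cons mxE rowi addr0 mxE big_ord1 mxE mulrC.
have Ga : gram (a :: s) *m a = a.
  have : gram (a :: s) *m col i (gram (a :: s)) = col i (gram (a :: s)).
    by rewrite colE mulmxA idem.
  by rewrite Gcol -scalemxAr => /(scalerI ai0).
have aTa : a^T *m a = (normsq a)%:M.
  by rewrite [LHS]mx11_scalar dotE; congr (_%:M); apply: eq_bigr => j _; rewrite expr2.
have Ga' : normsq a *: a + gram s *m a = a.
  by rewrite -[RHS]Ga gram_cons mulmxDl -mulmxA aTa mul_mx_scalar.
have a1 : normsq a = 1.
  have /colP/(_ i) := Ga'; rewrite !mxE big1 ?addr0; last first.
    by move=> j _; rewrite coli mul0r.
  by rewrite -[RHS]mul1r => /(mulIf ai0).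
have gsa : gram s *m a = 0.
  by apply: (addrI a); rewrite addr0 -[RHS]Ga' a1 scale1r.
have ort c : c \in s -> \sum_i a i 0 * c i 0 = 0.
  have : (a^T *m gram s *m a) 0 0 = 0 by rewrite -mulmxA gsa mulmx0 mxE.
  have -> : (a^T *m gram s *m a) 0 0 = \sum_(c <- s) (\sum_i a i 0 * c i 0) ^+ 2.
    rewrite /gram mulmx_sumr mulmx_suml summxE; apply: eq_bigr => e _.
    rewrite mulmxA -mulmxA mxE big_ord1 dotE expr2; congr (_ * _).
    by rewrite dotE; apply: eq_bigr => j _; rewrite mulrC.
  move=> /eqP; rewrite psumr_eq0 => [/allP h cs|e _]; last exact: sqr_ge0.
  by apply/eqP; rewrite -sqrf_eq0; exact: h.
split => //.
have ags : a *m a^T *m gram s = 0.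
  have gT : (gram s)^T = gram s.
    by apply/matrixP => j k; rewrite mxE !gramE; apply: eq_bigr => e _; rewrite mulrC.
  by rewrite -mulmxA -[a^T *m gram s]trmxK trmx_mul trmxK gT gsa trmx0 mulmx0.
have aaa : a *m a^T *m (a *m a^T) = a *m a^T.
  by rewrite mulmxA -[_ *m a^T *m a]mulmxA aTa a1 mulmx1.
move: idem; rewrite gram_cons mulmxDl !mulmxDr ags aaa [gram s *m (a *m _)]mulmxA gsa mul0mx.
by rewrite addr0 add0r => /addrI.
Qed.

(** The Gram matrix is the covariance of the Gaussian vector. When it is a
projector of trace [k], aligning a coordinate splits off a Gaussian multiple of
a unit vector orthogonal to the remaining ones, whose Gram matrix is a projector
of trace [k.-1]; this matches the recursion that defines the chi-square law. *)
Lemma gauss_mean_projector k s phi : gram s *m gram s = gram s ->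
  \tr (gram s) = k%:R -> measurable_fun setT phi -> (forall y, 0 <= phi y)%E ->
  (gauss_mean phi s 0 = \int[chi_square_prob k]_y phi y)%E.
Proof.
elim: k s phi => [|k IH] s phi idem trk mphi phi0.
  rewrite integral_chi_square0// gauss_mean0; last first.
    move=> a sa; apply: normsq_eq0; move: trk; rewrite trace_gram => /eqP.
    by rewrite psumr_eq0 => [/allP/(_ _ sa)/eqP//|e _]; exact: normsq_ge0.
  by congr phi; rewrite /normsq big1// => i _; rewrite mxE expr0n.
have [i Gii] : exists i, gram s i i != 0.
  apply/existsP; apply: contraPT trk; rewrite negb_exists => /forallP h.
  rewrite /mxtrace big1 => [/eqP|i _]; first by rewrite eq_sym pnatr_eq0.
  by apply/eqP; have := h i; rewrite negbK.
case: s idem trk Gii => [|a0 s0]; first by rewrite /gram big_nil mxE eqxx.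
have [a [s [_ si <- JE]]] := gauss_mean_align mphi phi0 s0 a0 i.
move=> idem trk Gii; rewrite -JE integral_chi_squareS//=.
have [a1 ort idem'] := aligned_projector idem si Gii.
apply: eq_integral => t _; rewrite add0r -[t *: a]addr0 gauss_mean_orthogonal; last 2 first.
- move=> c cs; have -> : \sum_j (t *: a) j 0 * c j 0 = t * \sum_j a j 0 * c j 0.
    by rewrite mulr_sumr; apply: eq_bigr => j _; rewrite mxE mulrA.
  by rewrite ort// mulr0.
- by rewrite big1// => j _; rewrite [X in _ * X]mxE mulr0.
rewrite normsqZ a1 mulr1 IH//; last 2 first.
- move: trk; rewrite gram_cons mxtraceD (_ : \tr (a *m a^T) = 1); last first.
    rewrite mxtrace_mulC (_ : a^T *m a = 1%:M) ?mxtrace1// [LHS]mx11_scalar dotE.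
    by congr (_%:M); rewrite -a1; apply: eq_bigr => j _; rewrite expr2.
  by rewrite -natr1 addrC => /addIr.
- apply: measurableT_comp => //; exact: (@measurable_funD _ _ R).
by apply: eq_integral => y _; rewrite addrC.
Qed.

End projector.
End chi_square.

(** * From signs to Gaussian variables *)

Section lindeberg.
Context {R : realType}.
Local Notation mR := (measurableTypeR R).
Local Notation leb := (@lebesgue_measure R).
Local Notation gamma := (@normal_prob R 0 1).

Lemma measurable_EFin_gauss_pdf : measurable_fun setT (fun t : mR => (gauss_pdf t)%:E).
Proof. apply/measurable_EFinP; exact: measurable_gauss_pdf. Qed.

Lemma normal_pdf_scale (s t : R) : 0 < s ->
  s * normal_pdf 0 s t = normal_peak 1 * expR (- (t ^+ 2 / 2 / s ^+ 2)).
Proof.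
move=> s0; rewrite /normal_pdf gt_eqF// mulrA; congr (_ * _).
  rewrite /normal_peak expr1n mul1r -mulrnAr sqrtrM ?sqr_ge0// sqrtr_sqr gtr0_norm//.
  by rewrite invfM mulVKf// gt_eqF.
rewrite /normal_fun subr0; congr expR; rewrite mulNr; congr (- _).
by rewrite -mulr_natr; field; rewrite gt_eqF.
Qed.

(** The masses of the centered normal laws of standard deviation [s < 1] bound
the second moment of the standard one from below; then [s] tends to 1. *)
Lemma gauss_second_moment_ge1 : (1 <= \int[gamma]_t (t ^+ 2)%:E)%E.
Proof.
have mt2 : measurable_fun setT (fun t : mR => (t ^+ 2)%:E).
  by apply/measurable_EFinP; exact: (@measurable_funX _ _ R).
rewrite integral_gauss//; last by move=> x; rewrite lee_fin sqr_ge0.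
have mt2g : measurable_fun setT (fun t : mR => ((t ^+ 2)%:E * (gauss_pdf t)%:E)%E).
  by apply: emeasurable_funM => //; exact: measurable_EFin_gauss_pdf.
have t2g0 (t : mR) : (0 <= (t ^+ 2)%:E * (gauss_pdf t)%:E)%E.
  by rewrite mule_ge0// lee_fin ?sqr_ge0 ?gauss_pdf_ge0.
set I := integral _ _ _.
have I0 : (0 <= I)%E by apply: integral_ge0 => t _.
rewrite leNgt; apply/negP => I1.
have Ifin : I \is a fin_num by rewrite ge0_fin_numE// (lt_trans I1)// ltry.
pose m := fine I; have IE : I = m%:E by rewrite /m fineK.
have m0 : 0 <= m by rewrite /m fine_ge0.
have m1 : m < 1 by rewrite -lte_fin -IE.
pose s : R := (1 + m) / 2.
have s0 : 0 < s by rewrite /s; lra.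
have s1 : s < 1 by rewrite /s; lra.
pose k := (s ^- 2 - 1) / 2.
have s21 : 1 <= s ^- 2.
  by rewrite -invr1 lef_pV2 ?posrE ?exprn_gt0// exprn_ile1 ?ltW.
have k0 : 0 <= k by rewrite divr_ge0// subr_ge0.
have main : ((1 : R)%:E <= s%:E + (k * m)%:E)%E.
  have -> : (k * m)%:E = (k%:E * I)%E by rewrite IE EFinM.
  rewrite -[X in (X <= _)%E](@integral_normal_pdf R 0 1) /I.
  rewrite -ge0_integralZl_EFin//.
  have -> : s%:E = (\int[leb]_t (s * normal_pdf 0 s t)%:E)%E.
    under eq_integral do rewrite EFinM.
    rewrite ge0_integralZl_EFin// ?(ltW s0) ?integral_normal_pdf ?mule1//.
    - by move=> t _; rewrite lee_fin normal_pdf_ge0.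
    - by apply/measurable_EFinP; exact: measurable_normal_pdf.
  have mp : measurable_fun setT (fun t : mR => (s * normal_pdf 0 s t)%:E).
    by apply/measurable_EFinP; apply: measurable_funM => //; exact: measurable_normal_pdf.
  have p0 (t : mR) : (0 <= (s * normal_pdf 0 s t)%:E)%E.
    by rewrite lee_fin mulr_ge0 ?(ltW s0) ?normal_pdf_ge0.
  have kg0 (t : mR) : (0 <= k%:E * ((t ^+ 2)%:E * (gauss_pdf t)%:E))%E.
    by rewrite mule_ge0// lee_fin.
  rewrite -ge0_integralD//; last exact: measurable_funeM.
  apply: ge0_le_integral => //.
  - by move=> t _; rewrite lee_fin normal_pdf_ge0.
  - by apply/measurable_EFinP; exact: measurable_normal_pdf.
  - by apply: emeasurable_funD => //; exact: measurable_funeM.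
  - move=> t _; rewrite gauss_pdfE normal_pdf_scale// -!EFinM -EFinD lee_fin /gauss_pdf.
    have -> : t ^+ 2 / 2 / s ^+ 2 = t ^+ 2 / 2 + k * t ^+ 2 by rewrite /k; field;
      rewrite gt_eqF.
    rewrite opprD expRD.
    have h : 1 - k * t ^+ 2 <= expR (- (k * t ^+ 2)) by rewrite expR_ge1Dx.
    set p := normal_peak 1; set e := expR (- (t ^+ 2 / 2)).
    have pe0 : 0 <= p * e by rewrite mulr_ge0 ?normal_peak_ge0 ?expR_ge0.
    have := ler_wpM2l pe0 h; rewrite mulrBr mulr1 => h2.
    have -> : k * (t ^+ 2 * (p * e)) = p * e * (k * t ^+ 2) by ring.
    by rewrite mulrA; lra.
move: main; rewrite -EFinD lee_fin.
have -> : k * m = (1 - s ^+ 2) / (2 * s ^+ 2) * m by rewrite /k; field; rewrite gt_eqF.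
have d0 : 0 < 2 * s ^+ 2 by apply: mulr_gt0 => //; exact: exprn_gt0.
rewrite -lerBlDl mulrAC (ler_pdivlMr _ _ d0).
have -> : m = 2 * s - 1 by rewrite /s; field.
have s10 : 0 < s + 1 by move: s0; lra.
have : 0 < (1 - s) ^+ 2 * (s + 1) by apply: mulr_gt0 => //; apply: exprn_gt0; rewrite subr_gt0.
by nra.
Qed.

Lemma integral_gauss_cst (c : \bar R) : (\int[gamma]_t (cst c t) = c)%E.
Proof. by rewrite integral_cst// [X in (_ * X)%E]probability_setT mule1. Qed.

(** The tangent inequality in [t ^+ 2] of [C2up_square_tangent], averaged over a
standard normal [t] and its opposite, has the right direction since the second
moment of [t] is at least 1 and the slope is nonnegative. *)
Lemma C2up_sign_le_gauss (f f1 f2 : R -> R) (x c : R) : C2up f f1 f2 ->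
  (((f (x + c) + f (x - c)) / 2)%:E <= \int[gamma]_t (f (x + t * c))%:E)%E.
Proof.
move=> fup; have [m m0 ht] := C2up_square_tangent fup x c.
have mlin (e : R) : measurable_fun setT (fun t : mR => x + t * e : mR).
  by apply: (@measurable_funD _ _ R) => //; apply: (@measurable_funM _ _ R).
have mf (e : R) : measurable_fun setT (fun t : mR => (f (x + t * e))%:E).
  apply/measurable_EFinP.
  exact: (measurableT_comp (continuous_measurable_fun (C2up_continuous fup)) (mlin e)).
have f0 (e : R) (t : mR) : (0 <= (f (x + t * e))%:E)%E by rewrite lee_fin (C2up_ge0 fup).
set I := integral _ _ _.
have IN : I = (\int[gamma]_t (f (x + t * - c))%:E)%E.
  rewrite /I -integral_gauss_oppr//; last exact: mf.
  by apply: eq_integral => t _; rewrite mulrN mulNr.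
have mt2 : measurable_fun setT (fun t : mR => (t ^+ 2)%:E).
  by apply/measurable_EFinP; exact: (@measurable_funX _ _ R).
have key : ((f (x + c) + f (x - c))%:E + m%:E <= I + I + m%:E)%E.
  rewrite {2}IN /I -ge0_integralD// -[X in (_ <= _ + X)%E]integral_gauss_cst.
  have mff : measurable_fun setT (fun t : mR => ((f (x + t * c))%:E + (f (x + t * - c))%:E)%E).
    by apply: emeasurable_funD.
  rewrite -ge0_integralD//; last by move=> t _; rewrite adde_ge0.
  apply: (@le_trans _ _ (\int[gamma]_t ((f (x + c) + f (x - c))%:E + (m%:E * (t ^+ 2)%:E)))%E).
    rewrite ge0_integralD//.
    - rewrite integral_gauss_cst leeD2l// ge0_integralZl_EFin//.
      + by rewrite -[leLHS]mule1 lee_wpmul2l ?lee_fin// gauss_second_moment_ge1.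
      + by move=> t _; rewrite lee_fin sqr_ge0.
    - by move=> t _; rewrite lee_fin addr_ge0// (C2up_ge0 fup).
    - by move=> t _; rewrite mule_ge0// lee_fin ?sqr_ge0.
    - exact: measurable_funeM.
  apply: ge0_le_integral => //.
  - move=> t _; rewrite adde_ge0//; first by rewrite lee_fin addr_ge0// (C2up_ge0 fup).
    by rewrite mule_ge0// lee_fin ?sqr_ge0.
  - by apply: emeasurable_funD => //; exact: measurable_funeM.
  - exact: emeasurable_funD.
  - by move=> t _; rewrite /cst -EFinM -!EFinD lee_fin mulrN; exact: ht.
move: key; rewrite leeD2rE// => key.
have -> : ((f (x + c) + f (x - c)) / 2)%:E = ((f (x + c) + f (x - c))%:E * 2^-1%:E)%E.
  by rewrite EFinM.
rewrite lee_pdivrMr// muleC.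
by rewrite mule_natl mule2n.
Qed.

(** For a line through the origin the square root is an absolute value, which
disappears by evenness. *)
Lemma C2up_profile (p : R) f f1 f2 : 0 <= p -> C2up f f1 f2 ->
  exists g1 g2, C2up (fun z => f (Num.sqrt (p ^+ 2 + z ^+ 2))) g1 g2.
Proof.
rewrite le_eqVlt => /orP[/eqP<-|p0] fup; last exact: (C2up_sqrt p0 fup).
exists f1, f2; rewrite (_ : (fun _ => _) = f)//; apply/funext => z.
rewrite expr0n add0r sqrtr_sqr; have [fN _ _ _ _] := fup.
by case: (ger0P z) => _; rewrite ?fN.
Qed.

Section radial.
Context {n : nat}.
Local Notation V := 'cV[R]_n.
Implicit Types (a b : V) (s : seq V).

Lemma normsqD a b (t : R) :
  normsq (b + t *: a) = normsq b + 2 * t * (\sum_i a i 0 * b i 0) + t ^+ 2 * normsq a.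
Proof.
rewrite /normsq !mulr_sumr -!big_split/=; apply: eq_bigr => i _.
by rewrite !mxE; ring.
Qed.

(** Here [p] is the distance of the line [b + t *: a] to the origin, and
[x + t * c] the abscissa on it measured from the foot of the perpendicular. *)
Lemma normsq_line a b : exists p x c, 0 <= p /\
  forall t : R, normsq (b + t *: a) = p ^+ 2 + (x + t * c) ^+ 2.
Proof.
have [->|a0] := eqVneq a 0.
  exists (Num.sqrt (normsq b)), 0, 0; split=> [|t]; first exact: sqrtr_ge0.
  by rewrite scaler0 addr0 mulr0 addr0 expr0n addr0 sqr_sqrtr// normsq_ge0.
have na0 : 0 < normsq a.
  rewrite lt_neqAle normsq_ge0 andbT eq_sym; apply: contra_neq a0.
  exact: normsq_eq0.
pose c := Num.sqrt (normsq a).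
have c0 : 0 < c by rewrite sqrtr_gt0.
have c_neq0 : c != 0 by rewrite gt_eqF.
have c2 : c ^+ 2 = normsq a by rewrite sqr_sqrtr// normsq_ge0.
pose d := \sum_i a i 0 * b i 0.
pose x := d / c.
have p2 : 0 <= normsq b - x ^+ 2.
  have := normsq_ge0 (b + (- (d / c ^+ 2)) *: a).
  by rewrite normsqD -c2 -/d; congr (0 <= _); rewrite /x; field.
exists (Num.sqrt (normsq b - x ^+ 2)), x, c; split=> [|t]; first exact: sqrtr_ge0.
by rewrite sqr_sqrtr// normsqD -c2 -/d /x; field.
Qed.

(** The expectation of [F (b + \sum_(a <- s) e_a *: a)] for independent
uniform signs [e_a]. *)
Fixpoint sign_mean (F : V -> R) s b : R :=
  if s is a :: s' then (sign_mean F s' (b + a) + sign_mean F s' (b - a)) / 2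
  else F b.

(** The functions for which a sign along any direction may be replaced by a
standard normal variable; averaging over further signs preserves this. *)
Let dominated (F : V -> R) := [/\ forall b, 0 <= F b,
  forall a b, measurable_fun setT (fun t : mR => F (b + t *: a)) &
  forall a b, (((F (b + a) + F (b - a)) / 2)%:E <=
    \int[gamma]_t (F (b + t *: a))%:E)%E].

Let dominated_sign_mean F s : dominated F -> dominated (sign_mean F s).
Proof.
move=> Fd; elim: s => [//|c s [S0 mS SJ]] /=; split.
- by move=> b; rewrite divr_ge0// addr_ge0.
- move=> a b; apply: (@measurable_funM _ mR R) => //.
  apply: (@measurable_funD _ mR R); [have := mS a (b + c)|have := mS a (b - c)];
  by under eq_fun do rewrite addrAC.
- move=> a b.
  have mSc e : measurable_fun setT (fun t : mR => (sign_mean F s (b + t *: a + e))%:E).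
    apply/measurable_EFinP; have := mS a (b + e).
    by under eq_fun do rewrite addrAC.
  have h e : (((sign_mean F s (b + a + e) + sign_mean F s (b - a + e)) / 2)%:E <=
      \int[gamma]_t (sign_mean F s (b + t *: a + e))%:E)%E.
    rewrite addrAC [b - a + e]addrAC; apply: (le_trans (SJ a (b + e))).
    by rewrite le_eqVlt; apply/orP; left; apply/eqP; apply: eq_integral => t _; rewrite addrAC.
  have -> : (\int[gamma]_t ((sign_mean F s (b + t *: a + c) + sign_mean F s
    (b + t *: a - c)) / 2)%:E =
    2^-1%:E * (\int[gamma]_t (sign_mean F s (b + t *: a + c))%:E +
      \int[gamma]_t (sign_mean F s (b + t *: a - c))%:E))%E.
    rewrite -ge0_integralD//; try by move=> t _; rewrite lee_fin.
    rewrite -ge0_integralZl_EFin//.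
    - by apply: eq_integral => t _; rewrite -EFinD -EFinM mulrC.
    - by move=> t _; rewrite adde_ge0// lee_fin.
    - exact: emeasurable_funD.
  have half0 : (0 <= (2^-1 : R)%:E)%E by rewrite lee_fin.
  apply: (le_trans _ (lee_wpmul2l half0 (leeD (h c) (h (- c)))));
    rewrite -EFinD -EFinM lee_fin le_eqVlt; apply/orP; left; apply/eqP.
  by field.
Qed.

Variables f f1 f2 : R -> R.
Hypothesis fup : C2up f f1 f2.

Definition radial b := f (Num.sqrt (normsq b)).

Let dominated_radial : dominated radial.
Proof.
have E a b : exists g x c, [/\ exists g1 g2, C2up g g1 g2 &
    forall t : R, radial (b + t *: a) = g (x + t * c)].
  have [p [x [c [p0 pE]]]] := normsq_line a b.
  exists (fun z => f (Num.sqrt (p ^+ 2 + z ^+ 2))), x, c; split.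
    exact: (C2up_profile p0 fup).
  by move=> t; rewrite /radial pE.
split.
- by move=> b; exact: (C2up_ge0 fup).
- move=> a b; have [g [x [c [[g1 [g2 gup]] gE]]]] := E a b.
  under eq_fun do rewrite gE.
  apply: (measurableT_comp (continuous_measurable_fun (C2up_continuous gup))).
  by apply: (@measurable_funD _ _ R) => //; apply: (@measurable_funM _ _ R).
- move=> a b; have [g [x [c [[g1 [g2 gup]] gE]]]] := E a b.
  under eq_integral do rewrite gE.
  have := C2up_sign_le_gauss x c gup; congr (((_ + _) / 2)%:E <= _)%E.
    by have := gE 1; rewrite scale1r mul1r.
  by have := gE (-1); rewrite scaleN1r mulN1r.
Qed.

(** The signs are replaced by standard normal variables one after the other. *)
Lemma sign_mean_le_gauss_mean s b :
  ((sign_mean radial s b)%:E <=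
   gauss_mean (fun y => (f (Num.sqrt y))%:E) s b)%E.
Proof.
have mphi : measurable_fun setT (fun y : mR => (f (Num.sqrt y))%:E).
  apply/measurable_EFinP.
  exact: (measurableT_comp (continuous_measurable_fun (C2up_continuous fup))
    (@measurable_sqrt_fun R)).
have phi0 (y : mR) : (0 <= (f (Num.sqrt y))%:E)%E by rewrite lee_fin (C2up_ge0 fup).
elim: s b => [//|a s IH] b /=.
have [S0 mS SJ] := dominated_sign_mean s dominated_radial.
apply: (le_trans (SJ a b)); apply: ge0_le_integral => //.
- by move=> t _; rewrite lee_fin.
- by apply/measurable_EFinP; exact: mS.
- apply: measurable_gauss_mean => // i.
  under eq_fun do rewrite !mxE.
  by apply: (@measurable_funD _ _ R) => //; apply: (@measurable_funM _ _ R).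
Qed.

End radial.
End lindeberg.

(** * From bounded centered variables to signs *)

Section signs.
Context {R : realType} {n : nat}.
Local Notation V := 'cV[R]_n.
Variable A : 'I_n -> V.
Implicit Types (F : V -> R) (b : V) (s : seq 'I_n) (x : 'I_n -> R).

(** The multi-affine interpolation, at the point [x] of the cube, of the values
of [fun x => F (b + \sum_(i <- s) x i *: A i)] at the sign vectors: its value
at a random [x] with independent centered coordinates has mean [sign_mean]. *)
Fixpoint interpolate F x s b : R :=
  if s is i :: s' then (1 + x i) / 2 * interpolate F x s' (b + A i)
    + (1 - x i) / 2 * interpolate F x s' (b - A i)
  else F b.

Let cube x := forall i, -1 <= x i <= 1.

(** The convexity that [C2up_le_sign] provides along each segment. *)
Let segment F := forall a b t, -1 <= t <= 1 ->
  F (b + t *: a) <= (1 + t) / 2 * F (b + a) + (1 - t) / 2 * F (b - a).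

Let segment_interpolate F x s : cube x -> segment F -> segment (interpolate F x s).
Proof.
move=> xc Fs; elim: s => [//|i s IH] a b t t1 /=.
have h1 : 0 <= (1 + x i) / 2 by have := xc i; lra.
have h2 : 0 <= (1 - x i) / 2 by have := xc i; lra.
have := lerD (ler_wpM2l h1 (IH a (b + A i) t t1)) (ler_wpM2l h2 (IH a (b - A i) t t1)).
rewrite addrAC [b - A i + _]addrAC => /le_trans; apply.
rewrite [b + A i + a]addrAC [b + A i - a]addrAC [b - A i + a]addrAC [b - A i - a]addrAC.
by rewrite le_eqVlt; apply/orP; left; apply/eqP; ring.
Qed.

Lemma interpolate_ge0 F x s b : cube x -> (forall b, 0 <= F b) -> 0 <= interpolate F x s b.
Proof.
move=> xc F0; elim: s b => [//|i s IH] b /=.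
by have := xc i => xi; rewrite addr_ge0// mulr_ge0//; lra.
Qed.

Lemma le_interpolate F x s b : cube x -> segment F ->
  F (b + \sum_(i <- s) x i *: A i) <= interpolate F x s b.
Proof.
move=> xc Fs; elim: s b => [|i s IH] b; first by rewrite big_nil addr0.
rewrite big_cons addrA; apply: (le_trans (IH _)).
exact: (segment_interpolate s xc Fs).
Qed.

Lemma segment_radial f f1 f2 : C2up f f1 f2 -> segment (radial f).
Proof.
move=> fup a b t t1; have [p [x [c [p0 pE]]]] := normsq_line a b.
have [g1 [g2 gup]] := C2up_profile p0 fup.
have := C2up_le_sign gup x c t1; rewrite /radial pE.
by have := pE 1; have := pE (-1); rewrite scale1r scaleN1r mul1r mulN1r => <- <-.
Qed.

Section random.
Local Open Scope ereal_scope.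
Context d (T : measurableType d) (Pr : probability T R).
Variable X : 'I_n -> T -> R.
Hypothesis mX : forall i, measurable_fun setT (X i).
Hypothesis X1 : forall i w, (-1 <= X i w <= 1)%R.
Hypothesis EX0 : forall i, \int[Pr]_w (X i w)%:E = 0.
Hypothesis indep : forall (J : {set 'I_n}) (B : 'I_n -> set R),
  (forall i, measurable (B i)) ->
  Pr (\bigcap_(i in [set` J]) X i @^-1` B i) = \prod_(i in J) Pr (X i @^-1` B i).

Let integrableX i : Pr.-integrable setT (fun w => (X i w)%:E).
Proof.
apply: measurable_bounded_integrable => //.
  by rewrite (le_lt_trans (probability_le1 _ _))// ltry.
exists 1%R; split; first exact: num_real.
move=> y y1 w _; rewrite /= ler_norml; have := X1 i w; move: y1; lra.
Qed.

Let half_mean i (e : R) : \int[Pr]_w ((1 + e * X i w) / 2)%:E = (2^-1)%:E.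
Proof.
under eq_integral do rewrite mulrDl EFinD mul1r mulrAC EFinM.
rewrite integralD//.
- rewrite integralZl// EX0 mule0 adde0.
  by rewrite (integral_cst Pr measurableT) [X in _ * X]probability_setT mule1.
- exact: finite_measure_integrable_cst.
- exact: integrableZl.
Qed.

Lemma measurable_interpolate F s b :
  measurable_fun setT (fun w => interpolate F (X^~ w) s b).
Proof.
elim: s b => [|i s IH] b //=.
apply: measurable_funD; apply: measurable_funM => //; apply: measurable_funM => //.
- exact: measurable_funD.
- exact: measurable_funB.
Qed.

Let event (J : {set 'I_n}) (B : 'I_n -> set R) := \bigcap_(i in [set` J]) X i @^-1` B i.

Let measurable_event (J : {set 'I_n}) (B : 'I_n -> set R) : (forall i, measurable
  (B i)) -> measurable (event J B).
Proof.
move=> mB; apply: fin_bigcap_measurable => // i _.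
by rewrite -[X in measurable X]setTI; exact: mX.
Qed.

(** The induction integrates out the head variable. For this the statement is
relative to an event [event J B] of the variables already processed: refining the
event by [X i] and using independence shows that, under the measure weighted by
the interpolation in the other variables, [X i] keeps its law up to a factor.
The affine factor [(1 + e * X i) / 2] then has mean one half. *)
Lemma mean_interpolate F s b (J : {set 'I_n})
  (B : 'I_n -> set R) : uniq s -> {in s, forall i, i \notin J} ->
  (forall b, (0 <= F b)%R) -> (forall i, measurable (B i)) ->
  \int[Pr]_(w in event J B) (interpolate F (X^~ w) s b)%:E =
  (sign_mean F (map A s) b)%:E * Pr (event J B).
Proof.
elim: s b J B => [|i s IH] b J B.
  by move=> _ _ F0 mB /=; rewrite integral_cst//; exact: measurable_event.
move=> /= /andP[si us] sJ F0 mB.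
have iJ : i \notin J by apply: sJ; rewrite mem_head.
set D := event J B; have mD : measurable D by exact: measurable_event.
have xc w : forall j, (-1 <= X j w <= 1)%R by move=> j.
have step c (e : R) : (e = 1 \/ e = -1)%R ->
    \int[Pr]_(w in D) ((1 + e * X i w) / 2 * interpolate F (X^~ w) s c)%:E =
    (2^-1 * sign_mean F (map A s) c)%:E * Pr D.
  move=> e1.
  set m := sign_mean F (map A s) c.
  have m0 : (0 <= m)%R.
    rewrite /m; elim: (s) (c) => [//|j s' IHs] c' /=.
    by rewrite divr_ge0// addr_ge0.
  have PD : Pr D \is a fin_num by rewrite fin_num_measure.
  have mPD0 : (0 <= m * fine (Pr D))%R by rewrite mulr_ge0// fine_ge0.
  pose nu := mscale (NngNum mPD0) (pushforward Pr (X i)).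
  pose wt w := (interpolate F (X^~ w) s c * \1_D w)%R.
  have wt0 w : (0 <= wt w)%R by rewrite mulr_ge0// interpolate_ge0.
  have mwt : measurable_fun setT wt.
    by apply: measurable_funM; [exact: measurable_interpolate|exact: measurable_indic].
  have e01 w : (0 <= (1 + e * X i w) / 2)%R.
    by have := X1 i w; case: e1 => -> ?; lra.
  pose h (y : R) : \bar R := (Num.max 0 ((1 + e * y) / 2))%:E.
  have mh : measurable_fun setT h.
    apply/measurable_EFinP; apply: measurable_maxr => //.
    by apply: measurable_funM => //; apply: measurable_funD => //; apply: measurable_funM.
  have h0 y : 0 <= h y by rewrite lee_fin le_max lexx.
  have hX w : h (X i w) = ((1 + e * X i w) / 2)%:E by rewrite /h max_r.
  have nuE C : measurable C -> nu (mX i) C = \int[Pr]_w (wt w * \1_C (X i w))%:E.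
    move=> mC; pose B' j := if j == i then C else B j.
    have mB' j : measurable (B' j) by rewrite /B'; case: ifP.
    have evE : event (i |: J) B' = D `&` X i @^-1` C.
      apply/seteqP; split=> w /=.
        move=> hw; split; last by have := hw i; rewrite /= setU11 /B' eqxx; exact.
        move=> j /= jJ; have := hw j; rewrite /= in_setU1 jJ orbT /B' => /(_ isT).
        by case: ifP => // /eqP ji; move: iJ; rewrite -ji jJ.
      move=> [wD wC] j /=; rewrite in_setU1 /B'; case: eqP => [-> //|_] /= jJ.
      exact: (wD j).
    have PrE : Pr (event (i |: J) B') = Pr (X i @^-1` C) * Pr D.
      rewrite /event indep// big_setU1//= {1}/B' eqxx; congr (_ * _).
      rewrite /D /event indep//; apply: eq_bigr => j jJ; rewrite /B'.
      by case: eqP => // ji; move: iJ; rewrite -ji jJ.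
    have := IH c (i |: J) B' us _ F0 mB'.
    rewrite -/m PrE evE => {}IH.
    rewrite [LHS](_ : _ = m%:E * (Pr (X i @^-1` C) * Pr D)); last first.
      by rewrite /nu /mscale/= /pushforward EFinM fineK// -muleA [Pr D * _]muleC.
    rewrite -IH; last first.
      move=> j js; rewrite in_setU1 negb_or sJ ?inE ?js ?orbT// andbT.
      by apply: contraNN si => /eqP <-.
    rewrite integral_mkcond; apply: eq_integral => w _.
    rewrite patchE /wt indicE indicE in_setI -mulrA -natrM mulnb.
    rewrite [X in _ && X](_ : _ = (X i w \in C)); last by apply/idP/idP; rewrite !inE.
    by case: (_ && _); rewrite ?mulr1 ?mulr0.
  transitivity (\int[Pr]_w (h (X i w) * (wt w)%:E)).
    rewrite integral_mkcond; apply: eq_integral => w _.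
    rewrite patchE hX -EFinM /wt indicE.
    by case: (w \in D); rewrite ?mulr1 ?mulr0.
  rewrite -(ge0_integral_density (mX i) mwt wt0 nuE mh h0).
  rewrite /nu ge0_integral_mscale//.
  rewrite ge0_integral_pushforward//=.
  under eq_integral do rewrite /= hX.
  by rewrite half_mean /= -(fineK PD) -!EFinM; congr EFin; ring.
have split_int : \int[Pr]_(w in D) ((1 + X i w) / 2 * interpolate F (X^~ w) s (b + A i)
    + (1 - X i w) / 2 * interpolate F (X^~ w) s (b - A i))%:E =
    \int[Pr]_(w in D) ((1 + 1 * X i w) / 2 * interpolate F (X^~ w) s (b + A i))%:E +
    \int[Pr]_(w in D) ((1 + (-1) * X i w) / 2 * interpolate F (X^~ w) s (b - A i))%:E.
  have mterm (e : R) c : measurable_fun D (fun w =>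
      ((1 + e * X i w) / 2 * interpolate F (X^~ w) s c)%:E).
    apply: measurable_funTS; apply/measurable_EFinP; apply: measurable_funM.
      by apply: measurable_funM => //; apply: measurable_funD => //; exact: measurable_funM.
    exact: measurable_interpolate.
  rewrite -ge0_integralD//.
  - by apply: eq_integral => w _; rewrite -EFinD mul1r mulN1r.
  - move=> w _; rewrite lee_fin mulr_ge0 ?interpolate_ge0//.
    by have := X1 i w; lra.
  - move=> w _; rewrite lee_fin mulr_ge0 ?interpolate_ge0//.
    by have := X1 i w; lra.
rewrite split_int !step; [|by right|by left].
have PD : Pr D \is a fin_num by rewrite fin_num_measure.
by rewrite -(fineK PD) -!EFinM -EFinD; congr EFin; field.
Qed.

End random.
End signs.

(** * The tail of the quadratic form *)

Section projector_form.
Context {R : realType} {n : nat}.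
Variable P : 'M[R]_n.

Let full_rank_factors k (C : 'M[R]_(n, k)) (D C' : 'M[R]_(k, n)) (D' : 'M[R]_(n, k)) :
  C' *m C = 1%:M -> D *m D' = 1%:M -> C *m D *m (C *m D) = C *m D -> D *m C = 1%:M.
Proof.
move=> CC DD /(congr1 (fun M => C' *m M *m D')).
by rewrite !mulmxA CC mul1mx -[_ *m D *m D']mulmxA DD mulmx1.
Qed.

(** A full rank factorization [P = C *m D] of a projector has [D *m C = 1%:M]. *)
Lemma trace_projector : P = P *m P -> \tr P = (\rank P)%:R.
Proof.
move=> idem; have PE := mulmx_base P.
have /row_fullP[C' CC] := col_base_full P.
have /row_freeP[D' DD] := row_base_free P.
have DC : row_base P *m col_base P = 1%:M.
  by apply: (full_rank_factors CC DD); rewrite PE -idem.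
by rewrite -[in LHS]PE mxtrace_mulC DC mxtrace1.
Qed.

Lemma gram_col : gram [seq col i P | i <- enum 'I_n] = P *m P^T.
Proof.
apply/matrixP => j k; rewrite gramE big_map big_enum/= mxE.
by apply: eq_bigr => i _; rewrite !mxE.
Qed.

Lemma normsq_col_sum (x : 'I_n -> R) : P = P^T -> P = P *m P ->
  normsq (\sum_(i <- enum 'I_n) x i *: col i P) = ((\col_i x i)^T *m P *m \col_i x i) 0 0.
Proof.
move=> sym idem.
have -> : \sum_(i <- enum 'I_n) x i *: col i P = P *m \col_i x i.
  rewrite big_enum/=; apply/colP => j; rewrite summxE mxE.
  by apply: eq_bigr => i _; rewrite !mxE mulrC.
have -> : (\col_i x i)^T *m P *m \col_i x i = (P *m \col_i x i)^T *m (P *m \col_i x i).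
  by rewrite trmx_mul -sym mulmxA -[_ *m P *m P]mulmxA -idem.
by rewrite dotE; apply: eq_bigr => j _; rewrite expr2.
Qed.

End projector_form.

Section bound.
Local Open Scope ereal_scope.
Context {R : realType} (n : nat) d (T : measurableType d) (Pr : probability T R).
Variable eta : 'I_n -> {RV Pr >-> R}.
Hypothesis eta_indep : mutually_independent eta.
Hypothesis eta_mean : forall i, 'E_Pr[eta i] = 0.
Hypothesis eta_bound : forall i, Pr [set w | (`|eta i w| <= 1)%R] = 1.

(** The variables are bounded almost surely only; clipping them changes each one
on a null set. *)
Let clip (y : R) : R := (Num.max (-1) (Num.min 1 y))%R.

Let measurable_clip : measurable_fun setT clip.
Proof. by apply: measurable_maxr => //; exact: measurable_minr. Qed.

Let clip_bound y : (-1 <= clip y <= 1)%R.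
Proof. by rewrite le_max lexx/= ge_max ge_min lexx/= andbT; lra. Qed.

Let clip_id y : (`|y| <= 1)%R -> clip y = y.
Proof. by rewrite ler_norml => /andP[y1 y2]; rewrite /clip min_r// max_r. Qed.

Let X i w := clip (eta i w).

Let mX i : measurable_fun setT (X i).
Proof. exact: measurableT_comp. Qed.

Let good := \bigcap_(i in [set` [set: 'I_n]%SET]) eta i @^-1` `[(-1)%R, 1%R]%classic.

Let mgood : measurable good.
Proof.
apply: fin_bigcap_measurable => // i _.
by rewrite -[X in measurable X]setTI; exact: measurable_funPT.
Qed.

Let good_clip w i : good w -> X i w = eta i w.
Proof.
move=> gw; apply: clip_id; have := gw i; rewrite /= finset.in_setT in_itv/= -ler_norml.
exact.
Qed.

Let Pr_bad : Pr (~` good) = 0.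
Proof.
rewrite probability_setC// [X in 1 - X](_ : _ = 1) ?subee//.
rewrite /good (@eta_indep _ (fun=> `[(-1)%R, 1%R]%classic))//.
rewrite big1// => i _; rewrite -[RHS](eta_bound i); congr (Pr _).
by apply/seteqP; split=> w /=; rewrite in_itv/= ler_norml.
Qed.

Let mean_X i : \int[Pr]_w (X i w)%:E = 0.
Proof.
rewrite -[RHS](eta_mean i) unlock; apply: ae_eq_integral => //.
- exact/measurable_EFinP.
- exact/measurable_EFinP.
- exists (~` good); split => //; first exact: measurableC.
  by move=> w /= h gw; apply: h => _; rewrite good_clip.
Qed.

Let indep_X (J : {set 'I_n}) (B : 'I_n -> set R) :
  (forall i, measurable (B i)) ->
  Pr (\bigcap_(i in [set` J]) X i @^-1` B i) = \prod_(i in J) Pr (X i @^-1` B i).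
Proof.
move=> mB; apply: (@eta_indep J (fun i => clip @^-1` B i)) => i.
by rewrite -[X in measurable X]setTI; exact: measurable_clip.
Qed.

(** The quadratic form is the squared norm of [\sum_i eta i *: col i P]. On its
tail [f u] is at most [radial f] of this sum, which the interpolation at the sign
vectors dominates; its mean is an average over signs, hence at most the Gaussian
one, which is chi-square because the Gram matrix of the columns is [P]. *)
Theorem projector_tail (P : 'M[R]_n) (f f1 f2 : R -> R) (u : R) :
  P = P^T -> P = P *m P -> C2up f f1 f2 -> (0 <= u)%R ->
  (f u)%:E * Pr [set w | (u ^+ 2 <= ((\col_i eta i w)^T *m P *m \col_i eta i w) 0 0)%R] <=
  \int[chi_square_prob (\rank P)]_y (f (Num.sqrt y))%:E.
Proof.
move=> sym idem fup u0.
have f0 y : (0 <= f y)%R by exact: (C2up_ge0 fup).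
pose A i := col i P; pose s := enum 'I_n.
pose quad w := normsq (\sum_(i <- s) eta i w *: A i)%R.
have quadE w : (((\col_i eta i w)^T *m P *m \col_i eta i w) 0 0 = quad w)%R.
  by rewrite -(normsq_col_sum _ sym idem).
have mquad : measurable_fun setT quad.
  rewrite /quad /normsq; apply: measurable_sum => j.
  apply: measurable_funX.
  under eq_fun do rewrite summxE.
  apply: measurable_sum => i.
  under eq_fun do rewrite mxE.
  exact: measurable_funM.
pose E := [set w | (u ^+ 2 <= quad w)%R].
have mE : measurable E.
  rewrite (_ : E = quad @^-1` `[(u ^+ 2)%R, +oo[%classic).
    by rewrite -[X in measurable X]setTI; exact: mquad.
  by apply/seteqP; split=> w /=; rewrite in_itv/= andbT.
rewrite (_ : [set w | _] = E); last by apply/seteqP; split => w /=; rewrite quadE.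
have G : gram (map A s) = P by rewrite gram_col -sym -idem.
have <- : gauss_mean (fun y => (f (Num.sqrt y))%:E) (map A s) 0%R =
    \int[chi_square_prob (\rank P)]_y (f (Num.sqrt y))%:E.
  apply: gauss_mean_projector; rewrite ?G -?idem ?trace_projector//.
  - apply/measurable_EFinP.
    exact: (measurableT_comp (continuous_measurable_fun (C2up_continuous fup))
      (@measurable_sqrt_fun R)).
  - by move=> y; rewrite lee_fin.
apply: (le_trans _ (sign_mean_le_gauss_mean fup (map A s) 0%R)).
have J0 : \bigcap_(i in [set` finset.set0]) X i @^-1` (setT : set R) = setT.
  by apply/seteqP; split=> // w _ i /=; rewrite finset.in_set0.
have := @mean_interpolate R n A _ T Pr X mX (fun i w => clip_bound _) mean_X indep_X
  (radial f) s 0%R finset.set0 (fun=> setT) (enum_uniq _) _ (fun b => f0 _)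
    (fun i => measurableT).
rewrite J0 probability_setT mule1 => <-; last by move=> i _; rewrite finset.in_set0.
have mI := measurable_interpolate A mX (radial f) s 0%R.
have I0 w : (0 <= interpolate A (radial f) (X^~ w) s 0)%R.
  by apply: interpolate_ge0 => [i|b]; [exact: clip_bound|exact: f0].
have -> : (f u)%:E * Pr E = \int[Pr]_w (f u * \1_E w)%:E.
  have := integral_indic Pr measurableT mE; rewrite setIT => <-.
  by rewrite -ge0_integralZl_EFin//; exact/measurable_EFinP.
apply: ae_ge0_le_integral => //.
- by move=> w _; rewrite lee_fin mulr_ge0.
- by apply/measurable_EFinP; exact: measurable_funM.
- by move=> w _; rewrite lee_fin.
- exact/measurable_EFinP.
exists (~` good); split => //; first exact: measurableC.
move=> w /= h gw; apply: h => _; rewrite lee_fin indicE.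
have [wE|_] := boolP (w \in E); last by rewrite mulr0 I0.
rewrite mulr1.
have xc i : (-1 <= X i w <= 1)%R by exact: clip_bound.
have := le_interpolate A s 0%R xc (segment_radial fup).
apply: le_trans; rewrite add0r /radial; apply: (C2up_nondecreasing fup) => //.
have -> : (\sum_(i <- s) X i w *: A i = \sum_(i <- s) eta i w *: A i)%R.
  by apply: eq_bigr => i _; rewrite good_clip.
rewrite -(ger0_norm u0) -sqrtr_sqr ler_wsqrtr//.
by move: wE; rewrite inE.
Qed.

End bound.

(** * The density of the chi law *)

Section chi_density.
Context {R : realType}.
Local Notation mR := (measurableTypeR R).
Local Notation leb := (@lebesgue_measure R).
Local Notation gamma := (@normal_prob R 0 1).
Implicit Types (F : mR -> \bar R) (k : nat) (x y z t : R).

(** The unnormalized density of [chi_prob k.+1]. *)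
Definition chi_weight k x : R :=
  if 0 < x then x ^+ k * expR (- (x ^+ 2 / 2)) else 0.

Lemma chi_weight_ge0 k x : 0 <= chi_weight k x.
Proof.
by rewrite /chi_weight; case: ifP => // x0; rewrite mulr_ge0 ?expR_ge0// exprn_ge0// ltW.
Qed.

Lemma measurable_gt0 : measurable_fun setT (fun x : mR => 0 < x).
Proof. by apply: (@measurable_fun_ltr _ mR R setT (fun=> 0) id). Qed.

Lemma measurable_chi_weight k : measurable_fun setT (chi_weight k : mR -> mR).
Proof.
apply: measurable_fun_ifT => //; first exact: measurable_gt0.
apply: (@measurable_funM _ mR R); first exact: (@measurable_funX _ mR R).
apply: measurableT_comp => //; apply: (@measurableT_comp _ _ _ _ _ _ (@GRing.opp R)) => //.
by apply: (@measurable_funM _ mR R) => //; exact: (@measurable_funX _ mR R).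
Qed.

Let measurable_weighted k F : measurable_fun setT F ->
  measurable_fun setT (fun x : mR => (F (x ^+ 2)%R * (chi_weight k x)%:E)%E).
Proof.
move=> mF; apply: emeasurable_funM.
  by apply: measurableT_comp => //; exact: (@measurable_funX _ mR R).
by apply/measurable_EFinP; exact: measurable_chi_weight.
Qed.

(** The constant is finite and positive since a probability has mass 1. *)
Let normalize k (D : \bar R) : (0 <= D)%E ->
  (forall F, measurable_fun setT F -> (forall y, 0 <= F y)%E ->
    \int[chi_square_prob k.+1]_y F y =
    D * \int[leb]_x (F (x ^+ 2)%R * (chi_weight k x)%:E))%E ->
  exists2 C : R, 0 < C & D = C%:E.
Proof.
move=> D0 /(_ (cst 1%E) (measurable_cst _) (fun=> lee01)).
rewrite integral_cst// [X in (_ * X)%E]probability_setT mule1.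
set I := integral _ _ _ => h.
have I0 : (0 <= I)%E.
  by apply: integral_ge0 => x _; rewrite mule_ge0// lee_fin chi_weight_ge0.
case: D D0 h => [C|_|//].
  rewrite lee_fin le_eqVlt => /orP[/eqP<-|C0 _]; last by exists C.
  by rewrite mul0e => /eqP; rewrite eqe oner_eq0.
move: I0; rewrite le_eqVlt => /orP[/eqP<-|I0].
  by rewrite mule0 => /eqP; rewrite eqe oner_eq0.
by rewrite gt0_mulye.
Qed.

Let density0 F : measurable_fun setT F -> (forall y, 0 <= F y)%E ->
  (\int[chi_square_prob 1]_y F y =
   (2 * normal_peak 1)%:E * \int[leb]_x (F (x ^+ 2)%R * (chi_weight 0 x)%:E))%E.
Proof.
move=> mF F0.
rewrite integral_chi_squareS//.
have mF2 : measurable_fun setT (fun z : mR => F (z ^+ 2)).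
  by apply: measurableT_comp => //; exact: (@measurable_funX _ mR R).
under eq_integral => z _.
  rewrite integral_chi_square0; last first.
    by apply: measurableT_comp => //; exact: (@measurable_funD _ mR R).
  rewrite add0r; over.
rewrite integral_gauss//.
pose G z := (F (z ^+ 2)%R * (chi_weight 0 z)%:E)%E.
have mG : measurable_fun setT (G : mR -> _) by exact: measurable_weighted.
have G0 z : (0 <= G z)%E by rewrite mule_ge0// lee_fin chi_weight_ge0.
have mGN : measurable_fun setT (fun z : mR => G (- z)).
  by apply: measurableT_comp => //; exact: oppr_measurable.
have p0 : 0 <= normal_peak 1 :> R by exact: normal_peak_ge0.
transitivity (\int[leb]_z ((normal_peak 1)%:E * (G z + G (- z)%R)))%E.
  apply: ge0_ae_eq_integral => //.
  - by apply: emeasurable_funM => //; apply/measurable_EFinP; exact: measurable_gauss_pdf.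
  - by apply: measurable_funeM; exact: emeasurable_funD.
  - by move=> z _; rewrite mule_ge0// lee_fin gauss_pdf_ge0.
  - by move=> z _; rewrite mule_ge0// ?lee_fin// adde_ge0.
  exists [set 0]; split => //; first exact: lebesgue_measure_set1.
  move=> z /= h; apply: contrapT => /eqP z0; apply: h => _.
  rewrite /G sqrrN /chi_weight !expr0 !mul1r sqrrN oppr_gt0 /gauss_pdf.
  have [zlt|zgt|zE] := ltgtP z 0; last by move: z0; rewrite zE eqxx.
  - by rewrite mule0 add0e muleCA EFinM.
  - by rewrite mule0 adde0 muleCA EFinM.
rewrite ge0_integralZl_EFin//; last 2 first.
- by move=> z _; rewrite adde_ge0.
- exact: emeasurable_funD.
rewrite ge0_integralD// -(ge0_integral_oppr mG G0).
by rewrite mulrC EFinM -muleA mule_natl mule2n.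
Qed.

(** The length of the vector [(1, t)], for the coordinates of [polar]. *)
Let stretch t : R := Num.sqrt (1 + t ^+ 2).

Let stretch_gt0 t : 0 < stretch t.
Proof. by rewrite sqrtr_gt0 ltr_pwDl// sqr_ge0. Qed.

Let stretch_sqr t : stretch t ^+ 2 = 1 + t ^+ 2.
Proof. by rewrite sqr_sqrtr// addr_ge0// sqr_ge0. Qed.

Let measurable_inv_stretch k : measurable_fun setT (fun t : mR => (stretch t)^-1 ^+ k : mR).
Proof.
apply: (@measurable_funX _ mR R); apply: continuous_measurable_fun => t.
apply: (@continuousV _ _ _ _); first by rewrite gt_eqF.
apply: continuous_comp; last exact: sqrt_continuous.
apply: (is_derive_continuous (a := 2 * t)).
by apply: (is_derive_eq (derD (der_cst 1 t) (derX 1 (der_id t)))); ring.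
Qed.

(** Integration in the coordinates [(x, z) = (w, w * t) / sqrt (1 + t ^+ 2)]:
for a fixed [x] scale [z], then for a fixed [t] scale [x]. *)
Let polar k (Phi : mR -> \bar R) : measurable_fun setT Phi -> (forall y, 0 <= Phi y)%E ->
  (\int[leb]_z \int[leb]_x (Phi (x ^+ 2 + z ^+ 2)%R * (if 0 < x then x ^+ k else 0)%:E) =
   \int[leb]_t ((stretch t)^-1 ^+ k.+2)%:E *
   \int[leb]_w (Phi (w ^+ 2)%R * (if 0 < w then w ^+ k.+1 else 0)%:E))%E.
Proof.
move=> mPhi Phi0.
have pos_ge0 m x : 0 <= (if 0 < x then x ^+ m else 0).
  by case: ifP => // x0; rewrite exprn_ge0// ltW.
have mpos m : measurable_fun setT (fun x : mR => (if 0 < x then x ^+ m else 0) : mR).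
  by apply: measurable_fun_ifT => //; exact: measurable_gt0.
have msq m (f g : mR * mR -> mR) : measurable_fun setT f -> measurable_fun setT g ->
    measurable_fun setT (fun z : mR * mR =>
      (Phi (f z ^+ 2 + g z ^+ 2)%R * (if 0 < z.1 then z.1 ^+ m else 0)%:E)%E).
  move=> mf mg; apply: emeasurable_funM.
    apply: measurableT_comp => //.
    by apply: (@measurable_funD _ _ R); exact: (@measurable_funX _ _ R).
  apply/measurable_EFinP; exact: (measurableT_comp (mpos m) measurable_fst).
(* joint integrand after the first substitution, in (x, t) *)
pose H (z : mR * mR) : \bar R :=
  (Phi (z.1 ^+ 2 + (z.1 * z.2) ^+ 2)%R * (if 0 < z.1 then z.1 ^+ k.+1 else 0)%:E)%E.
have mH : measurable_fun setT H.
  have mm : measurable_fun setT (fun z : mR * mR => z.1 * z.2 : mR).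
    by apply: (@measurable_funM _ _ R).
  exact: (msq k.+1 _ _ measurable_fst mm).
have H0 (v : mR * mR) : (0 <= H v)%E by rewrite mule_ge0// lee_fin pos_ge0.
pose K (z : mR * mR) : \bar R :=
  (Phi (z.1 ^+ 2 + z.2 ^+ 2)%R * (if 0 < z.1 then z.1 ^+ k else 0)%:E)%E.
have mK : measurable_fun setT K by exact: (msq k _ _ measurable_fst measurable_snd).
have K0 (v : mR * mR) : (0 <= K v)%E by rewrite mule_ge0// lee_fin pos_ge0.
transitivity (\int[leb]_x \int[leb]_z K (x, z))%E.
  by rewrite (@fubini_tonelli _ _ mR mR R leb leb K mK K0).
transitivity (\int[leb]_x \int[leb]_t H (x, t))%E.
  apply: eq_integral => x _.
  have [x0|x0] := ltP 0 x.
    rewrite (@ge0_integral_affine R (fun z => K (x, z)) 0 x x0 (measurable_pair_r mK x)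
      (fun z => K0 _)).
    rewrite -ge0_integralZl_EFin ?(ltW x0)//; last first.
      exact: (measurableT_comp (measurable_pair_r mK x) (measurable_affine 0 x)).
    apply: eq_integral => t _; rewrite /K /H/= x0 add0r muleCA -EFinM.
    by rewrite -exprS.
  rewrite [LHS]integral0_eq ?[RHS]integral0_eq//; move=> t _;
    by rewrite /H/K/= (le_gtF x0) mule0.
rewrite (@fubini_tonelli _ _ mR mR R leb leb H mH H0).
have mw : measurable_fun setT (fun w : mR => (Phi (w ^+ 2)%R *
  (if 0 < w then w ^+ k.+1 else 0)%:E)%E).
  apply: emeasurable_funM; last by apply/measurable_EFinP; exact: mpos.
  by apply: measurableT_comp => //; exact: (@measurable_funX _ mR R).
have w0 w : (0 <= Phi (w ^+ 2)%R * (if 0 < w then w ^+ k.+1 else 0)%:E)%E.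
  by rewrite mule_ge0// lee_fin pos_ge0.
rewrite muleC -ge0_integralZl//; last 3 first.
- by apply/measurable_EFinP; exact: measurable_inv_stretch.
- by move=> t _; rewrite lee_fin exprn_ge0// invr_ge0 ltW.
- by apply: integral_ge0 => w _.
apply: eq_integral => t _.
have st0 : 0 < (stretch t)^-1 by rewrite invr_gt0.
rewrite (@ge0_integral_affine R (fun x => H (x, t)) 0 _ st0 (measurable_pair_l mH t)
  (fun z => H0 _)).
have c0 : 0 <= (stretch t)^-1 ^+ k.+2 by rewrite exprn_ge0// ltW.
rewrite [RHS]muleC.
rewrite -(@ge0_integralZl_EFin _ mR R leb setT measurableT _ (fun w _ => w0 w) mw _ c0).
rewrite -[LHS]ge0_integralZl_EFin ?(ltW st0)//; last first.
  exact: (measurableT_comp (measurable_pair_l mH t) (measurable_affine 0 _)).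
apply: eq_integral => w _; rewrite /H/= add0r.
have -> : (stretch t)^-1 * w * t = (stretch t)^-1 * (w * t) by rewrite mulrA.
have -> : ((stretch t)^-1 * w) ^+ 2 + ((stretch t)^-1 * (w * t)) ^+ 2 = w ^+ 2.
  rewrite !exprMn exprVn stretch_sqr; field.
  by rewrite gt_eqF// ltr_pwDl// sqr_ge0.
rewrite pmulr_rgt0// [LHS]muleCA [RHS]muleCA -!EFinM; congr (_ * _%:E)%E.
by case: ifP => // _; rewrite ?mulr0// [in RHS]exprS exprMn mulrA.
Qed.

(** Each step of the induction adds an independent Gaussian square to the
radius, and the plane integral so obtained is rotation invariant up to the
power of [x]; the polar change of variables turns it into one radial integral
times a constant. *)
Theorem chi_density k : exists2 C : R, 0 < C & forall F,
  measurable_fun setT F -> (forall y, 0 <= F y)%E ->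
  (\int[chi_square_prob k.+1]_y F y =
   C%:E * \int[leb]_x (F (x ^+ 2)%R * (chi_weight k x)%:E))%E.
Proof.
elim: k => [|k [C C0 IH]].
  exists (2 * normal_peak 1); last exact: density0.
  by rewrite mulr_gt0// normal_peak_gt0 ?oner_eq0.
have p0 : 0 <= normal_peak 1 :> R by exact: normal_peak_ge0.
pose L := (\int[leb]_t ((stretch t)^-1 ^+ k.+2)%:E)%E.
have L0 : (0 <= L)%E.
  by apply: integral_ge0 => t _; rewrite lee_fin exprn_ge0// invr_ge0 ltW.
suff h F : measurable_fun setT F -> (forall y, 0 <= F y)%E ->
    (\int[chi_square_prob k.+2]_y F y = (C * normal_peak 1)%:E * L *
      \int[leb]_x (F (x ^+ 2)%R * (chi_weight k.+1 x)%:E))%E.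
  have D0 : (0 <= (C * normal_peak 1)%:E * L)%E by rewrite mule_ge0// lee_fin mulr_ge0// ltW.
  by have [D Dpos DE] := normalize D0 h; exists D => // F mF F0; rewrite h// DE.
move=> mF F0.
have mFE : measurable_fun setT (fun y : mR => (expR (- (y / 2)))%:E : \bar R).
  apply/measurable_EFinP; apply: measurableT_comp => //.
  apply: (@measurableT_comp _ _ _ _ _ _ (@GRing.opp R)) => //.
  exact: (@measurable_funM _ mR R).
pose Phi y := (F y * (expR (- (y / 2)))%:E)%E.
have mPhi : measurable_fun setT (Phi : mR -> _) by exact: emeasurable_funM.
have Phi0 y : (0 <= Phi y)%E by rewrite mule_ge0// lee_fin expR_ge0.
have pos_ge0 m x : 0 <= (if 0 < x then x ^+ m else 0).
  by case: ifP => // x0; rewrite exprn_ge0// ltW.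
have mpos m : measurable_fun setT (fun x : mR => (if 0 < x then x ^+ m else 0) : mR).
  by apply: measurable_fun_ifT => //; exact: measurable_gt0.
pose G (z : mR * mR) : \bar R :=
  (Phi (z.2 ^+ 2 + z.1 ^+ 2)%R * (if 0 < z.2 then z.2 ^+ k else 0)%:E)%E.
have mG : measurable_fun setT G.
  apply: emeasurable_funM.
    apply: measurableT_comp => //.
    by apply: (@measurable_funD _ _ R); exact: (@measurable_funX _ _ R).
  apply/measurable_EFinP; exact: (measurableT_comp (mpos k) measurable_snd).
have G0 (v : mR * mR) : (0 <= G v)%E by rewrite mule_ge0// lee_fin pos_ge0.
have mGz z : measurable_fun setT (fun x : mR => G (z, x)) := measurable_pair_r mG z.
have mIG : measurable_fun setT (fun z : mR => \int[leb]_x G (z, x))%E.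
  exact: (@measurable_fun_fubini_tonelli_F _ _ mR mR R leb G mG G0).
have IG0 z : (0 <= \int[leb]_x G (z, x))%E by exact: integral_ge0.
rewrite integral_chi_squareS//.
have mFz z : measurable_fun setT (fun y : mR => F (y + z ^+ 2)).
  by apply: measurableT_comp => //; exact: (@measurable_funD _ mR R).
have inner (z : R) : (\int[chi_square_prob k.+1]_y F (y + z ^+ 2)%R =
    C%:E * \int[leb]_x (F (x ^+ 2 + z ^+ 2)%R * (chi_weight k x)%:E))%E.
  by rewrite (IH (fun y => F (y + z ^+ 2)))//.
under eq_integral do rewrite inner.
have minner : measurable_fun setT
    (fun z : mR => C%:E * \int[leb]_x (F (x ^+ 2 + z ^+ 2)%R * (chi_weight k x)%:E))%E.
  apply: measurable_funeM.
  apply: (@measurable_fun_fubini_tonelli_F _ _ mR mR R leb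
    (fun v : mR * mR => F (v.2 ^+ 2 + v.1 ^+ 2)%R * (chi_weight k v.2)%:E)%E).
    apply: emeasurable_funM.
      apply: measurableT_comp => //.
      by apply: (@measurable_funD _ _ R); exact: (@measurable_funX _ _ R).
    apply/measurable_EFinP.
    exact: (measurableT_comp (@measurable_chi_weight k) measurable_snd).
  by move=> v; rewrite mule_ge0// lee_fin chi_weight_ge0.
rewrite integral_gauss//; last first.
  move=> z; apply: mule_ge0; first by rewrite lee_fin ltW.
  by apply: integral_ge0 => x _; rewrite mule_ge0// lee_fin chi_weight_ge0.
transitivity (\int[leb]_z ((C * normal_peak 1)%:E * \int[leb]_x G (z, x)))%E.
  apply: eq_integral => z _.
  rewrite (EFinM C) -[LHS]muleA -[RHS]muleA; congr (_ * _)%E.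
  rewrite muleC -ge0_integralZl_EFin ?gauss_pdf_ge0//; last 2 first.
  - by move=> x _; rewrite mule_ge0// lee_fin chi_weight_ge0.
  - apply: emeasurable_funM; last first.
      by apply/measurable_EFinP; exact: measurable_chi_weight.
    by apply: measurableT_comp => //; apply: (@measurable_funD _ mR R) => //;
      exact: (@measurable_funX _ mR R).
  rewrite -(@ge0_integralZl_EFin _ mR R leb setT measurableT _ (fun x _ => G0 (z, x))
    (mGz z) _ p0).
  apply: eq_integral => x _; rewrite /G/= /Phi /chi_weight.
  case: ifP => _; last by rewrite !mule0.
  have -> : - ((x ^+ 2 + z ^+ 2) / 2) = - (x ^+ 2 / 2) + - (z ^+ 2 / 2) by lra.
  rewrite /gauss_pdf muleCA [RHS]muleC -!muleA -!EFinM expRD; congr (_ * _%:E)%E.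
  ring.
rewrite ge0_integralZl_EFin//; last by rewrite mulr_ge0// ltW.
rewrite (polar k mPhi Phi0) -muleA; congr (_ * (_ * _))%E.
apply: eq_integral => w _; rewrite /Phi /chi_weight.
case: ifP => _; last by rewrite !mule0.
by rewrite -muleA -EFinM mulrC.
Qed.

End chi_density.

(** * Gamma integrals *)

Section gamma_integral.
Context {R : realType}.
Local Notation mR := (measurableTypeR R).
Local Notation leb := (@lebesgue_measure R).
Implicit Types (j : nat) (x y l t : R).

Lemma is_derive_expRN x : is_derive x 1 (fun y : R => expR (- y)) (- expR (- x)).
Proof.
apply: (is_derive_eq (@der_comp R expR (fun y => - y) _ _ _ (is_derive_expR _) (derN
  (der_id x)))).
by rewrite mulrN1.
Qed.

(** The polynomial [P] with [P - P^`() = 'X^j], so that [- expR (- y) * P y] is a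
primitive of [y ^+ j * expR (- y)]. *)
Fixpoint gamma_poly j y : R :=
  if j is i.+1 then y ^+ j + j%:R * gamma_poly i y else 1.

Lemma gamma_poly0 j : gamma_poly j 0 = j`!%:R.
Proof. by elim: j => [//|j IH]; rewrite /= expr0n add0r IH factS natrM. Qed.

Lemma is_derive_gamma_poly j y :
  is_derive y 1 (gamma_poly j) (gamma_poly j y - y ^+ j).
Proof.
elim: j => [|j IH]; first by rewrite /= expr0 subrr; exact: der_cst.
rewrite [gamma_poly j.+1]/=.
apply: (is_derive_eq (derD (derX j (der_id y)) (derM (der_cst j.+1%:R y) IH))).
by ring.
Qed.

(** One term of the exponential series of exponent above [j] is enough. *)
Lemma cvg_expn_expRN j : y ^+ j * expR (- y) @[y --> +oo] --> (0 : R).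
Proof.
apply: (@squeeze_cvgr _ _ _ _ (fun=> 0) (fun y : R => j.+1`!%:R * y^-1)); last 2 first.
- exact: cvg_cst.
- rewrite -[X in _ --> X](mulr0 j.+1`!%:R); apply: cvgM; first exact: cvg_cst.
  apply: (gtr0_cvgV0 _ (f := id)).2; last exact: cvg_id.
  by near=> y; near: y; exact: nbhs_pinfty_gt.
near=> y; have y0 : 0 < y by near: y; exact: nbhs_pinfty_gt.
rewrite mulr_ge0 ?expR_ge0 ?exprn_ge0 ?(ltW y0)//=.
rewrite expRN ler_pdivrMr ?expR_gt0// mulrAC ler_pdivlMr// -exprSr.
have := expR_ge1Dxn j (ltW y0).
rewrite addrC -lerBrDr => h.
rewrite mulrC -ler_pdivrMr ?ltr0n ?fact_gt0//; apply: (le_trans h).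
by rewrite gerBl.
Unshelve. all: by end_near. Qed.

Lemma cvg_gamma_poly_expRN j : gamma_poly j y * expR (- y) @[y --> +oo] --> (0 : R).
Proof.
elim: j => [|j IH].
  rewrite /=; under eq_fun do rewrite mul1r; exact: cvgr_expR.
have -> : (fun y => gamma_poly j.+1 y * expR (- y)) =
    (fun y => y ^+ j.+1 * expR (- y) + j.+1%:R * (gamma_poly j y * expR (- y))).
  by apply/funext => y /=; rewrite mulrDl mulrA.
rewrite -[X in _ --> X](addr0 0) -[X in _ --> _ + X](mulr0 j.+1%:R).
by apply: cvgD; [exact: cvg_expn_expRN|apply: cvgM => //; exact: cvg_cst].
Qed.

Lemma integral_expn_expRN j :
  (\int[leb]_(y in `[0%R, +oo[) (y ^+ j * expR (- y))%:E = (j`!%:R)%:E)%E.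
Proof.
have dF (y : R) : is_derive y 1 (fun y => - (gamma_poly j y * expR (- y))) (y ^+ j * expR
  (- y)).
  apply: (is_derive_eq (derN (derM (is_derive_gamma_poly j y) (is_derive_expRN y)))).
  by ring.
rewrite (@ge0_continuous_FTC2y R _ (fun y => - (gamma_poly j y * expR (- y))) 0 0).
- by rewrite gamma_poly0 oppr0 expR0 mulr1 -EFinB opprK add0r.
- by move=> y y0; rewrite mulr_ge0 ?expR_ge0 ?exprn_ge0.
- apply: continuous_subspaceT => y; case: j {dF} => [|j].
    exact: (is_derive_continuous (derM (der_cst 1 y) (is_derive_expRN y))).
  exact: (is_derive_continuous (derM (derX j (der_id y)) (is_derive_expRN y))).
- by rewrite -[X in _ --> X]oppr0; apply: cvgN; exact: cvg_gamma_poly_expRN.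
- by move=> y _; exact: (@ex_derive _ _ _ _ _ _ _ (dF y)).
- apply: cvg_at_right_filter; exact: (is_derive_continuous (dF 0)).
- by move=> y _; rewrite derive1E; exact: (@derive_val _ _ _ _ _ _ _ (dF y)).
Qed.

Lemma integral_shifted_gamma j l t : 0 < l ->
  (\int[leb]_x (if t <= x then (x - t) ^+ j * expR (- (l * (x - t))) else 0)%:E =
   (j`!%:R / l ^+ j.+1)%:E)%E.
Proof.
move=> l0.
have mH : measurable_fun setT
    (fun x : mR => (if t <= x then (x - t) ^+ j * expR (- (l * (x - t))) else 0)%:E : \bar R).
  apply/measurable_EFinP; apply: measurable_fun_ifT => //.
    exact: (@measurable_fun_ler _ mR R setT (fun=> t) id).
  have mB : measurable_fun setT (fun x : mR => x - t : mR) by exact: (@measurable_funB _ mR R).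
  apply: (@measurable_funM _ mR R); first exact: (@measurable_funX _ mR R).
  apply: measurableT_comp => //; apply: (@measurableT_comp _ _ _ _ _ _ (@GRing.opp R)) => //.
  exact: (@measurable_funM _ mR R).
have H0 x : (0 <= (if t <= x then (x - t) ^+ j * expR (- (l * (x - t))) else 0)%:E)%E.
  by rewrite lee_fin; case: ifP => // tx; rewrite mulr_ge0 ?expR_ge0 ?exprn_ge0 ?subr_ge0.
have li0 : 0 < l^-1 by rewrite invr_gt0.
rewrite (ge0_integral_affine t li0 mH H0).
rewrite (_ : (j`!%:R / l ^+ j.+1)%:E = (l^-1)%:E * ((l^-1 ^+ j)%:E * (j`!%:R)%:E))%E;
  last first.
  by rewrite -!EFinM mulrA -exprS mulrC exprVn.
congr (_ * _)%E; rewrite -integral_expn_expRN.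
rewrite -ge0_integralZl_EFin//; last 3 first.
- move=> x; rewrite /= in_itv/= andbT => x0.
  by rewrite lee_fin mulr_ge0 ?expR_ge0 ?exprn_ge0.
- apply: measurable_funTS; apply/measurable_EFinP.
  apply: (@measurable_funM _ mR R); first exact: (@measurable_funX _ mR R).
  apply: measurableT_comp => //; exact: (@measurableT_comp _ _ _ _ _ _ (@GRing.opp R)).
- by rewrite exprn_ge0// ltW.
rewrite [RHS]integral_mkcond; apply: eq_integral => x _; rewrite patchE mem_setE in_itv/= andbT.
rewrite lerDl pmulr_rge0//; case: ifP => // _.
rewrite -EFinM; congr EFin.
rewrite addrAC subrr add0r exprMn -mulrA; congr (_ * (_ * expR (- _))).
by rewrite mulrA mulfV ?mul1r// gt_eqF.
Qed.

End gamma_integral.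

(** * Comparison of two densities with the same tail mass *)

Section strict_integral.
Context d (T : measurableType d) (R : realType) (mu : measure T R).
Local Open Scope ereal_scope.

(** A nonnegative function of zero integral vanishes almost everywhere. *)
Lemma integral_gt0 (f : T -> \bar R) (E : set T) : measurable_fun setT f ->
  (forall x, 0 <= f x) -> measurable E -> 0 < mu E -> (forall x, E x -> 0 < f x) ->
  0 < \int[mu]_x f x.
Proof.
move=> mf f0 mE muE fE; rewrite lt_neqAle integral_ge0// andbT.
apply/eqP => /esym I0; move: muE; rewrite (_ : mu E = 0) ?ltxx//.
have := (ae_eq_integral_abs mu measurableT mf).1.
under eq_integral do rewrite gee0_abs//.
move=> /(_ I0) ae0; apply: measure_negligible => //.
apply: negligibleS ae0 => x Ex /= /(_ I) fx0.
by move: (fE x Ex); rewrite fx0 ltxx.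
Qed.

Lemma lt_integral (f g : T -> R) (E : set T) :
  measurable_fun setT f -> measurable_fun setT g ->
  (forall x, 0 <= f x <= g x)%R -> measurable E -> 0 < mu E ->
  (forall x, E x -> f x < g x)%R -> \int[mu]_x (f x)%:E < +oo ->
  \int[mu]_x (f x)%:E < \int[mu]_x (g x)%:E.
Proof.
move=> mf mg fg mE muE fgE foo.
have f0 x : (0 <= f x)%R by case/andP: (fg x).
have h0 x : (0 <= g x - f x)%R by case/andP: (fg x); rewrite subr_ge0.
have mh : measurable_fun setT (fun x => (g x - f x)%:E).
  by apply/measurable_EFinP; exact: measurable_funB.
have -> : \int[mu]_x (g x)%:E = \int[mu]_x (f x)%:E + \int[mu]_x (g x - f x)%:E.
  rewrite -ge0_integralD//; last 3 first.
  - by move=> x _; rewrite lee_fin.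
  - exact/measurable_EFinP.
  - by move=> x _; rewrite lee_fin.
  by apply: eq_integral => x _; rewrite -EFinD addrC subrK.
rewrite lteDl; last first.
  by rewrite ge0_fin_numE// integral_ge0// => x _; rewrite lee_fin.
apply: (integral_gt0 mh _ mE muE) => x; first by rewrite lee_fin.
by move=> /fgE; rewrite lte_fin subr_gt0.
Qed.

End strict_integral.

Section single_crossing.
Context {R : realType}.
Local Notation mR := (measurableTypeR R).
Local Notation leb := (@lebesgue_measure R).
Implicit Types (x u w t : R).

(** Before [u] one has [rho < nu]. Beyond [u], the difference [rho - nu] is
nonnegative up to [w] and nonpositive after, while [g - g w] has the opposite
sign, so that [(g - g w) * (rho - nu)] is nonpositive; the term in [g w]
integrates to 0 beyond [u] because the masses there agree. The strict inequality
comes from the interval between [t] and [u]. *)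
Lemma single_crossing (rho nu g : R -> R) u w t (q : R) :
  measurable_fun setT (rho : mR -> mR) -> measurable_fun setT (nu : mR -> mR) ->
  measurable_fun setT (g : mR -> mR) ->
  (forall x, 0 <= rho x) -> (forall x, 0 <= nu x) -> (forall x, 0 <= g x) ->
  {homo g : x y / x <= y} -> u <= w ->
  (forall x, x < u -> rho x < nu x) -> (forall x, u <= x < w -> nu x <= rho x) ->
  (forall x, w < x -> rho x <= nu x) ->
  (\int[leb]_x (if u <= x then rho x else 0)%:E = q%:E)%E ->
  (\int[leb]_x (if u <= x then nu x else 0)%:E = q%:E)%E ->
  t < u -> (forall x, t < x -> 0 < g x) ->
  (\int[leb]_x (g x * nu x)%:E < +oo)%E ->
  (\int[leb]_x (g x * rho x)%:E < \int[leb]_x (g x * nu x)%:E)%E.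
Proof.
move=> mrho mnu mg rho0 nu0 g0 gmono uw below above beyond qrho qnu tu gt0 fin.
have mcut (h : R -> R) : measurable_fun setT (h : mR -> mR) ->
    measurable_fun setT (fun x : mR => g w * (if u <= x then h x else 0) : mR).
  move=> mh; apply: (@measurable_funM _ mR R) => //; apply: measurable_fun_ifT => //.
  exact: (@measurable_fun_ler _ mR R setT (fun=> u) id).
have cut0 (h : R -> R) : (forall x, 0 <= h x) ->
    forall x, 0 <= g w * (if u <= x then h x else 0).
  by move=> h0 x; rewrite mulr_ge0//; case: ifP.
have mgr : measurable_fun setT (fun x : mR => g x * rho x : mR) by exact:
  (@measurable_funM _ mR R).
have mgn : measurable_fun setT (fun x : mR => g x * nu x : mR) by exact:
  (@measurable_funM _ mR R).
have split (h h' : R -> R) : measurable_fun setT (fun x : mR => g x * h x : mR) ->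
    measurable_fun setT (h' : mR -> mR) -> (forall x, 0 <= h x) -> (forall x, 0 <= h' x) ->
    (\int[leb]_x (if u <= x then h' x else 0)%:E = q%:E)%E ->
    (\int[leb]_x (g x * h x + g w * (if u <= x then h' x else 0))%:E =
     \int[leb]_x (g x * h x)%:E + (g w * q)%:E)%E.
  move=> mh mh' h0 h'0 qE; under eq_integral do rewrite EFinD.
  rewrite ge0_integralD//; last 4 first.
  - by move=> x _; rewrite lee_fin mulr_ge0.
  - exact/measurable_EFinP.
  - by move=> x _; rewrite lee_fin cut0.
  - by apply/measurable_EFinP; exact: mcut.
  congr (_ + _)%E; under eq_integral do rewrite EFinM.
  rewrite ge0_integralZl_EFin ?qE ?EFinM//.
    by move=> x _; rewrite lee_fin; case: ifP.
  apply/measurable_EFinP; apply: measurable_fun_ifT => //.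
  exact: (@measurable_fun_ler _ mR R setT (fun=> u) id).
have pointwise x : 0 <= g x * rho x + g w * (if u <= x then nu x else 0) <=
    g x * nu x + g w * (if u <= x then rho x else 0).
  apply/andP; split.
    by apply: addr_ge0; [rewrite mulr_ge0|exact: (cut0 _ nu0)].
  have [ux|xu] := leP u x; last first.
    by rewrite !mulr0 !addr0 ler_wpM2l// ltW// below.
  rewrite -subr_ge0.
  have -> : g x * nu x + g w * rho x - (g x * rho x + g w * nu x) =
    (g w - g x) * (rho x - nu x) by ring.
  have [xw|wx|->] := ltgtP x w; last by rewrite subrr mul0r.
  - by rewrite mulr_ge0 ?subr_ge0 ?gmono ?above ?ux// ltW.
  - by rewrite mulr_le0 ?subr_le0 ?gmono ?beyond// ltW.
have mL : measurable_fun setT (fun x : mR => g x * rho x + g w *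
  (if u <= x then nu x else 0) : mR).
  by apply: (@measurable_funD _ mR R) => //; exact: mcut.
have mU : measurable_fun setT (fun x : mR => g x * nu x + g w *
  (if u <= x then rho x else 0) : mR).
  by apply: (@measurable_funD _ mR R) => //; exact: mcut.
have finL : (\int[leb]_x (g x * rho x + g w * (if u <= x then nu x else 0))%:E < +oo)%E.
  apply: (@le_lt_trans _ _ (\int[leb]_x (g x * nu x + g w *
    (if u <= x then rho x else 0))%:E)%E).
    apply: ge0_le_integral => //.
    - by move=> x _; rewrite lee_fin; case/andP: (pointwise x).
    - exact/measurable_EFinP.
    - exact/measurable_EFinP.
    - by move=> x _; rewrite lee_fin; case/andP: (pointwise x).
  by rewrite split// lte_add_pinfty// ltry.
have mE : measurable (`]t, u[%classic : set mR) by exact: measurable_itv.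
have leb0 : (0 < leb `]t, u[)%E by rewrite lebesgue_measure_itv/= lte_fin tu lte_fin subr_gt0.
have := lt_integral mL mU pointwise mE leb0 _ finL.
rewrite !split// lteD2rE//; apply => x /=; rewrite in_itv/= => /andP[tx xu].
by rewrite (lt_geF xu) !mulr0 !addr0 ltr_pM2l ?gt0 ?below.
Qed.

End single_crossing.

(** * Comparison of the chi law with an exponential *)

Section chi_tail.
Context {R : realType}.
Local Notation mR := (measurableTypeR R).
Local Notation leb := (@lebesgue_measure R).
Implicit Types (j k : nat) (t u x y : R).

Lemma chi_prob_density k : exists2 C : R, 0 < C & forall f : mR -> R,
  measurable_fun setT f -> (forall x, 0 <= f x) ->
  (\int[chi_prob k.+1]_x (f x)%:E =
   \int[leb]_x (f x * (C * chi_weight k x))%:E)%E.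
Proof.
have [C C0 CE] := @chi_density R k; exists C => // f mf f0.
have mEf : measurable_fun setT (fun x : mR => (f x)%:E : \bar R) by exact/measurable_EFinP.
transitivity (\int[chi_square_prob k.+1]_y (f (sqrt_fun y))%:E)%E.
  have f0E (y : mR) : (0 <= (f y)%:E)%E by rewrite lee_fin.
  exact: (@ge0_integral_distribution _ _ _ _ R (chi_square_prob k.+1) (@sqrt_fun R) _ mEf f0E).
rewrite (CE (fun y => (f (sqrt_fun y))%:E)); last 2 first.
- exact: (measurableT_comp mEf (@measurable_sqrt_fun R)).
- by move=> y; rewrite lee_fin.
rewrite -ge0_integralZl_EFin ?(ltW C0)//; last 2 first.
- by move=> x _; rewrite mule_ge0 ?lee_fin ?chi_weight_ge0.
- apply: emeasurable_funM; last by apply/measurable_EFinP; exact: measurable_chi_weight.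
  apply: (measurableT_comp mEf); apply: (measurableT_comp (@measurable_sqrt_fun R)).
  exact: (@measurable_funX _ mR R).
apply: eq_integral => x _; rewrite -!EFinM mulrCA.
rewrite /chi_weight; case: ifP => x0; last by rewrite !mulr0.
by rewrite /sqrt_fun sqrtr_sqr gtr0_norm.
Qed.

Lemma measurable_ler_set u : measurable ([set x : mR | u <= x]).
Proof.
have -> : [set x : mR | u <= x] = `[u, +oo[%classic by rewrite set_itvcy.
exact: measurable_itv.
Qed.

Lemma measurable_cut u (h : R -> R) : measurable_fun setT (h : mR -> mR) ->
  measurable_fun setT (fun x : mR => (if u <= x then h x else 0) : mR).
Proof.
move=> mh; apply: measurable_fun_ifT => //.
exact: (@measurable_fun_ler _ mR R setT (fun=> u) id).
Qed.

(** The logarithm of the ratio of [chi_weight k x] to [expR (- (l * (x - u)))],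
normalized to vanish at [u]. *)
Definition log_ratio k l u x : R :=
  k%:R * (ln x - ln u) - (x ^+ 2 - u ^+ 2) / 2 + l * (x - u).

Lemma log_ratio_id k l u : log_ratio k l u u = 0.
Proof. by rewrite /log_ratio !subrr mulr0 mul0r mulr0 subr0 addr0. Qed.

Lemma chi_weight_log_ratio k l u x : 0 < u -> 0 < x ->
  chi_weight k x = chi_weight k u * expR (- (l * (x - u))) * expR (log_ratio k l u x).
Proof.
move=> u0 x0; rewrite /chi_weight u0 x0.
have powE y : 0 < y -> y ^+ k = expR (k%:R * ln y).
  by move=> y0; rewrite expRM_natl lnK.
rewrite !powE// -!expRD; congr expR; rewrite /log_ratio; lra.
Qed.

(** Strict concavity of [log_ratio], in the form of tangent lines. *)
Lemma log_ratio_tangent k l u x y : 0 < x -> 0 < y ->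
  log_ratio k l u y <=
  log_ratio k l u x + (k%:R / x - x + l) * (y - x) - (y - x) ^+ 2 / 2.
Proof.
move=> x0 y0.
have lnB : ln y - ln x <= y / x - 1.
  rewrite -ln_div ?posrE// -[X in ln X](subrK 1) addrC.
  by apply: le_ln1Dx; rewrite ltrBrDl subrr divr_gt0.
have k0 : 0 <= k%:R :> R by [].
have /= := ler_wpM2l k0 lnB.
have -> : k%:R * (y / x - 1) = k%:R / x * (y - x).
  by field; rewrite gt_eqF.
rewrite /log_ratio; set p := ln y; set q := ln x; set s := ln u; set c := k%:R / x.
nra.
Qed.

(** A concave function vanishing at [u] and nonnegative at some [z > u] has a
positive slope at [u], hence is negative before. *)
Lemma log_ratio_lt0 k l u x z : 0 < x -> x < u -> u < z -> 0 <= log_ratio k l u z ->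
  log_ratio k l u x < 0.
Proof.
move=> x0 xu uz az.
have u0 := lt_trans x0 xu; have z0 := lt_trans u0 uz.
have := log_ratio_tangent k l u u0 z0; have := log_ratio_tangent k l u u0 x0.
rewrite log_ratio_id !add0r; set m := k%:R / u - u + l => hx hz.
have d0 : 0 < z - u by rewrite subr_gt0.
have e0 : 0 < u - x by rewrite subr_gt0.
have m0 : 0 < m by rewrite ltNge; apply/negP => m0; nra.
by apply: (le_lt_trans hx); nra.
Qed.

Lemma log_ratio_ge0 k l u x z : 0 < u -> u <= x -> x < z -> 0 <= log_ratio k l u z ->
  0 <= log_ratio k l u x.
Proof.
move=> u0 ux xz az.
have x0 := lt_le_trans u0 ux; have z0 := lt_trans x0 xz.
have := log_ratio_tangent k l u x0 z0; have := log_ratio_tangent k l u x0 u0.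
rewrite log_ratio_id; set m := k%:R / x - x + l; set a := log_ratio k l u x => hu hz.
rewrite leNgt; apply/negP => a0.
have [m0|m0] := leP 0 m; nra.
Qed.

Lemma log_ratio_bounded k l u x : 0 < u -> u < x -> 2 * (k%:R / u + l) <= x ->
  log_ratio k l u x < 0.
Proof.
move=> u0 ux xb; have x0 := lt_trans u0 ux.
have := log_ratio_tangent k l u u0 x0.
rewrite log_ratio_id add0r; set c := k%:R / u in xb * => h.
apply: (le_lt_trans h); nra.
Qed.

(** The density of [chi_prob k.+1] is compared with the exponential [nu] that has
the same value at [u] and the same mass on [u, +oo[. Their ratio is log-concave
and equals 1 at [u], so that the densities cross at [u] and, the masses being
equal, once more at some [w]: this is [single_crossing], and the right-hand side
is the integral against [nu]. *)
Theorem chi_power_mean_lt k u : 0 < u ->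
  exists2 l : R, 0 < l & forall (f : mR -> R) j t,
    measurable_fun setT f -> (forall x, 0 <= f x) -> t < u ->
    (forall x, 0 < x -> f x = if t <= x then (x - t) ^+ j else 0) ->
    (\int[chi_prob k.+1]_x (f x)%:E <
     chi_prob k.+1 [set x | u <= x]%R * (expR (l * (u - t)) * (j`!%:R / l ^+ j))%:E)%E.
Proof.
move=> u0; have [C C0 CE] := chi_prob_density k.
pose rho x := C * chi_weight k x.
have rho0 x : 0 <= rho x by rewrite mulr_ge0 ?chi_weight_ge0 ?ltW.
have rho_gt0 x : 0 < x -> 0 < rho x.
  by move=> x0; rewrite /rho /chi_weight x0 !mulr_gt0 ?exprn_gt0 ?expR_gt0.
have mrho : measurable_fun setT (rho : mR -> mR).
  by apply: (@measurable_funM _ mR R) => //; exact: measurable_chi_weight.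
have mE : measurable (`]u, (u + 1)[%classic : set mR) by exact: measurable_itv.
have lebE : (0 < leb `]u, (u + 1)%R[)%E.
  by rewrite lebesgue_measure_itv/= lte_fin ltrDl ltr01 lte_fin subr_gt0 ltrDl ltr01.
have qrho0 : (chi_prob k.+1 [set x | u <= x]%R = \int[leb]_x
  (if u <= x then rho x else 0)%:E)%E.
  have mA := measurable_ler_set u.
  rewrite -[X in chi_prob _ X]setIT -(integral_indic _ measurableT mA).
  rewrite CE//; apply: eq_integral => x _.
  rewrite indicE (_ : (x \in _) = (u <= x)); last by apply/idP/idP; rewrite inE.
  by case: (u <= x); rewrite ?mul1r ?mul0r.
have mcut (h : R -> R) : measurable_fun setT (h : mR -> mR) ->
    measurable_fun setT (fun x : mR => (if u <= x then h x else 0)%:E : \bar R).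
  by move=> mh; apply/measurable_EFinP; exact: measurable_cut.
pose q := fine (chi_prob k.+1 [set x | u <= x]%R).
have qE : chi_prob k.+1 [set x | u <= x]%R = q%:E.
  by rewrite fineK//; apply: fin_num_measure; exact: measurable_ler_set.
have q0 : 0 < q.
  rewrite -lte_fin -qE qrho0; apply: (integral_gt0 (mcut _ mrho) _ mE lebE) => x.
    by rewrite lee_fin; case: ifP.
  by rewrite /= in_itv/= => /andP[ux _]; rewrite ltW// lte_fin rho_gt0// (lt_trans u0).
have {}qrho0 := etrans (esym qrho0) qE.
pose l := rho u / q; have l0 : 0 < l by rewrite divr_gt0// rho_gt0.
pose nu x := rho u * expR (- (l * (x - u))).
have nu_gt0 x : 0 < nu x by rewrite mulr_gt0 ?expR_gt0 ?rho_gt0.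
have nu0 x : 0 <= nu x by rewrite ltW.
have mnu : measurable_fun setT (nu : mR -> mR).
  apply: (@measurable_funM _ mR R) => //; apply: measurableT_comp => //.
  apply: (@measurableT_comp _ _ _ _ _ _ (@GRing.opp R)) => //.
  by apply: (@measurable_funM _ mR R) => //; exact: (@measurable_funB _ mR R).
(* the weighted mass of [nu] beyond any point *)
have nu_mass j t : (\int[leb]_x ((if t <= x then (x - t) ^+ j else 0) * nu x)%:E =
    q%:E * (expR (l * (u - t)) * (j`!%:R / l ^+ j))%:E)%E.
  have nuE x : nu x = rho u * expR (l * (u - t)) * expR (- (l * (x - t))).
    by rewrite -mulrA -expRD; congr (_ * expR _); ring.
  transitivity (\int[leb]_x ((rho u * expR (l * (u - t)))%:E *
      (if t <= x then (x - t) ^+ j * expR (- (l * (x - t))) else 0)%:E))%E.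
    apply: eq_integral => x _; rewrite -EFinM; congr EFin.
    by rewrite nuE; case: ifP => _; rewrite ?mul0r ?mulr0// mulrCA.
  have mh : measurable_fun setT
      (fun x : mR => (x - t) ^+ j * expR (- (l * (x - t))) : mR).
    have mB : measurable_fun setT (fun x : mR => x - t : mR) by exact:
      (@measurable_funB _ mR R).
    apply: (@measurable_funM _ mR R); first exact: (@measurable_funX _ mR R).
    apply: measurableT_comp => //; apply: (@measurableT_comp _ _ _ _ _ _ (@GRing.opp R)) => //.
    exact: (@measurable_funM _ mR R).
  rewrite ge0_integralZl_EFin//; last 3 first.
  - move=> x _; rewrite lee_fin; case: ifP => // tx.
    by rewrite mulr_ge0 ?expR_ge0 ?exprn_ge0 ?subr_ge0.
  - by apply/measurable_EFinP; exact: (measurable_cut t mh).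
  - by rewrite mulr_ge0 ?expR_ge0.
  rewrite integral_shifted_gamma// -!EFinM; congr EFin.
  rewrite /l exprS; field.
  by rewrite !gt_eqF ?exprn_gt0 ?rho_gt0.
have qnu : (\int[leb]_x (if u <= x then nu x else 0)%:E = q%:E)%E.
  have := nu_mass 0 u; rewrite subrr mulr0 expR0 !divr1 !mulr1 mule1 => <-.
  by apply: eq_integral => x _; case: ifP => _; rewrite ?expr0 ?mul1r ?mul0r.
have rhoE x : 0 < x -> rho x = nu x * expR (log_ratio k l u x).
  by move=> x0; rewrite /rho /nu/rho (chi_weight_log_ratio k l u0 x0) !mulrA.
have rho_lt x : 0 < x -> log_ratio k l u x < 0 -> rho x < nu x.
  by move=> x0 a0; rewrite rhoE// -[ltRHS]mulr1 ltr_pM2l// expR_lt1.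
have rho_ge x : 0 < x -> 0 <= log_ratio k l u x -> nu x <= rho x.
  by move=> x0 a0; rewrite rhoE// -[leLHS]mulr1 ler_pM2l// -expR0 ler_expR.
(* equal masses force the densities to cross beyond [u] *)
have [z uz az] : exists2 z, u < z & 0 <= log_ratio k l u z.
  apply: contrapT => noz.
  have lt x : u < x -> rho x < nu x.
    move=> ux; apply: rho_lt; first exact: lt_trans ux.
    by rewrite ltNge; apply/negP => ax; apply: noz; exists x.
  have : (\int[leb]_x (if u <= x then rho x else 0)%:E <
          \int[leb]_x (if u <= x then nu x else 0)%:E)%E.
    apply: (lt_integral (measurable_cut _ mrho) (measurable_cut _ mnu) _ mE lebE).
    - move=> x; case: ifP => ux; last by rewrite lexx.
      rewrite rho0/=.
      move: ux; rewrite le_eqVlt => /orP[/eqP<-|/lt/ltW//].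
      by rewrite /nu subrr mulr0 oppr0 expR0 mulr1.
    - by move=> x; rewrite /= in_itv/= => /andP[ux _]; rewrite (ltW ux) lt.
    - by rewrite qrho0 ltry.
  by rewrite qrho0 qnu ltxx.
pose S : set R := [set x | u <= x /\ 0 <= log_ratio k l u x].
have Su : S u by rewrite /S/= log_ratio_id lexx.
have Sub : has_ubound S.
  exists (Num.max u (2 * (k%:R / u + l))) => x [ux ax].
  rewrite leNgt; apply/negP; rewrite gt_max => /andP[ux' bx].
  by have := log_ratio_bounded u0 ux' (ltW bx); rewrite ltNge ax.
pose w := sup S.
have uw : u <= w by exact: ub_le_sup.
exists l => // f j t mf f0 tu fE.
pose g x : R := if t <= x then (x - t) ^+ j else 0.
have g0 x : 0 <= g x by rewrite /g; case: ifP => // tx; rewrite exprn_ge0 ?subr_ge0.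
rewrite qE -nu_mass CE//.
rewrite (_ : \int[leb]_x _ = \int[leb]_x (g x * rho x)%:E)%E; last first.
  apply: eq_integral => x _; congr EFin.
  have [x0|x0] := ltP 0 x; first by rewrite fE.
  by rewrite /rho /chi_weight (le_gtF x0) !mulr0.
apply: (@single_crossing R rho nu g u w t q) => //.
- apply: (@measurable_cut t (fun x => (x - t) ^+ j)); apply: (@measurable_funX _ mR R).
  exact: (@measurable_funB _ mR R).
- move=> x y xy; rewrite /g; case: ifP => tx; last by case: ifP => // ty;
    rewrite exprn_ge0 ?subr_ge0.
  by rewrite (le_trans tx xy) lerXn2r ?nnegrE ?subr_ge0 ?lerD2r// (le_trans tx).
- move=> x xu; have [x0|x0] := ltP 0 x.
    by apply: rho_lt => //; exact: log_ratio_lt0 az.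
  by rewrite /rho /chi_weight (le_gtF x0) mulr0.
- move=> x /andP[ux xw]; have x0 := lt_le_trans u0 ux.
  have [y [uy ay] xy] := sup_gt (ex_intro _ u Su) xw.
  by apply: rho_ge => //; exact: log_ratio_ge0 ay.
- move=> x wx; have ux := le_lt_trans uw wx.
  apply/ltW/rho_lt; first exact: lt_trans ux.
  rewrite ltNge; apply/negP => ax.
  have Sx : S x by split => //; exact: ltW.
  by have := ub_le_sup Sub Sx; rewrite leNgt wx.
- by move=> x tx; rewrite /g (ltW tx) exprn_gt0 ?subr_gt0.
- by rewrite nu_mass -EFinM ltry.
Qed.

End chi_tail.

(** * Test functions and numerical bounds *)

Section test_functions.
Context {R : realType}.
Implicit Types (t x : R).

Lemma convexR_cst (c : R) : convexR (fun=> c).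
Proof. by move=> s x y _; rewrite le_eqVlt; apply/orP; left; apply/eqP; ring. Qed.

Lemma C2up_cst1 : C2up (fun=> 1 : R) (fun=> 0) (fun=> 0).
Proof.
split => //; last exact: convexR_cst; move=> x; exact: der_cst.
Qed.

Lemma C2up_sqr : C2up (fun x : R => x ^+ 2) (fun x => 2 * x) (fun=> 2).
Proof.
split; [exact: sqrrN|move=> x|move=> x|exact: convexR_cst|by rewrite expr0n].
- by apply: (is_derive_eq (derX 1 (der_id x))); rewrite expr1 mulr1.
- by apply: (is_derive_eq (derM (der_cst 2 x) (der_id x))); rewrite mul0r add0r mulr1.
Qed.

(** The even extension of [fun x => Num.max (x - t) 0 ^+ 3]. *)
Definition cubic_hinge t x : R := Num.max (x - t) 0 ^+ 3 + Num.max (- x - t) 0 ^+ 3.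

Lemma C2up_cubic_hinge t : C2up (cubic_hinge t)
  (fun x => 3 * Num.max (x - t) 0 ^+ 2 - 3 * Num.max (- x - t) 0 ^+ 2)
  (fun x => 6 * Num.max (x - t) 0 + 6 * Num.max (- x - t) 0).
Proof.
have m0 y : 0 <= Num.max y 0 :> R by rewrite le_max lexx orbT.
have dl x : is_derive x 1 (fun z : R => z - t) 1.
  by apply: (is_derive_eq (derD (der_id x) (der_cst (- t) x))); rewrite addr0.
have dr x : is_derive x 1 (fun z : R => - z - t) (-1).
  by apply: (is_derive_eq (derD (derN (der_id x)) (der_cst (- t) x))); rewrite addr0.
split.
- by move=> x; rewrite /cubic_hinge opprK addrC.
- move=> x; apply: (is_derive_eq (derD (@der_comp R _ (fun z => z - t) _ _ _
    (is_derive_max0 1 _) (dl x))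
    (@der_comp R _ (fun z => - z - t) _ _ _ (is_derive_max0 1 _) (dr x)))).
  ring.
- move=> x; apply: (is_derive_eq (derD
    (derM (der_cst 3 x) (@der_comp R _ (fun z => z - t) _ _ _ (is_derive_max0 0 _) (dl x)))
    (derN (derM (der_cst 3 x)
      (@der_comp R _ (fun z => - z - t) _ _ _ (is_derive_max0 0 _) (dr x)))))).
  ring.
- have hinge s x y : 0 <= s <= 1 ->
      Num.max (s * x + (1 - s) * y) 0 <= s * Num.max x 0 + (1 - s) * Num.max y 0.
    move=> /andP[s0 s1]; have s1' : 0 <= 1 - s by rewrite subr_ge0.
    rewrite ge_max addr_ge0 ?mulr_ge0//= andbT.
    by rewrite lerD// ler_wpM2l// le_max lexx.
  move=> s x y s01.
  have := hinge s (x - t) (y - t) s01; have := hinge s (- x - t) (- y - t) s01.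
  have -> : s * (x - t) + (1 - s) * (y - t) = s * x + (1 - s) * y - t by ring.
  have -> : s * (- x - t) + (1 - s) * (- y - t) = - (s * x + (1 - s) * y) - t by ring.
  lra.
- by rewrite /cubic_hinge; split; rewrite addr_ge0 ?exprn_ge0 ?mulr_ge0.
Qed.

Lemma cubic_hingeE t x : 0 <= t -> 0 <= x ->
  cubic_hinge t x = if t <= x then (x - t) ^+ 3 else 0.
Proof.
move=> t0 x0; rewrite /cubic_hinge [X in _ + X](_ : _ = 0) ?addr0; last first.
  by rewrite max_r ?expr0n//; lra.
by case: leP => tx; [rewrite max_l ?subr_ge0|rewrite max_r ?expr0n// subr_le0 ltW].
Qed.

End test_functions.

(** The quantity [expR v * j`! / v ^+ j] is compared, for [j] equal to 0 and 2, with
its value [2 * expR 3 / 9] at [j = 3] and [v = 3]. Both bounds rest on a numerical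
one for [expR (4 / 5)]. *)
Section numeric.
Context {R : realType}.
Implicit Types v y : R.

Lemma expR_4_5 : 15 / 7 < expR (4 / 5) :> R.
Proof.
(* [1.1 ^ 8 = 2.1435...] exceeds [15 / 7 = 2.1428...] *)
have -> : 4 / 5 = 8%:R * (1 / 10) :> R by field.
rewrite expRM_natl.
have h : 11 / 10 <= expR (1 / 10) :> R by apply: le_trans (expR_ge1Dx _); lra.
apply: (@lt_le_trans _ _ ((11 / 10) ^+ 8)); first lra.
by rewrite lerXn2r// nnegrE ?expR_ge0//; lra.
Qed.

Lemma expR_lt_small v : v <= 7 / 5 -> expR v < 2 * expR 3 / 9.
Proof.
move=> v1; have := expR_4_5; set e := expR (4 / 5) => he.
have -> : expR (3 : R) = expR (7 / 5) * (e * e).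
  by rewrite -!expRD; congr expR; field.
have ve : expR v <= expR (7 / 5) by rewrite ler_expR.
apply: (le_lt_trans ve).
have := expR_gt0 (7 / 5 : R); set b := expR (7 / 5) => b0.
have e2 : 9 / 2 < e * e by nra.
nra.
Qed.

(** With [y = (3 - v) / 2] the claim is [expR (- y) < v / 3], which is the chord
bound for the convex function [expR (- y)] on [0, 4 / 5]. *)
Lemma expR_lt_mid v : 7 / 5 <= v -> v < 3 -> expR v * (2 / v ^+ 2) < 2 * expR 3 / 9.
Proof.
move=> v1 v3.
pose y := (3 - v) / 2.
have [y0 y1] : 0 < y /\ y <= 4 / 5 by rewrite /y; split; lra.
(* combine the tangent at [y] taken at the two ends of [0, 4 / 5] *)
have chord : expR (- y) < v / 3.
  have h0 : expR (- y) * (1 + y) <= 1.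
    rewrite -[leRHS](expRxMexpNx_1 y) mulrC ler_wpM2r ?expR_ge0//.
    exact: expR_ge1Dx.
  have h1 : expR (- y) * (1 + (y - 4 / 5)) <= expR (- (4 / 5)).
    rewrite [leRHS](_ : _ = expR (- y) * expR (y - 4 / 5)); last first.
      by rewrite -expRD; congr expR; ring.
    by rewrite ler_wpM2l ?expR_ge0// expR_ge1Dx.
  have h2 : expR (- (4 / 5)) < 7 / 15 :> R.
    have := expRxMexpNx_1 (4 / 5 : R); have := expR_4_5.
    set e := expR (4 / 5); set W := expR _ => he hW.
    by rewrite ltNge; apply/negP => W1; nra.
  have -> : v / 3 = 1 - y * (2 / 3) by rewrite /y; field.
  move: h0 h1 h2; set E := expR (- y); set W := expR _ => h0 h1 h2.
  nra.
have E0 := expR_gt0 (- y).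
have -> : expR v = expR 3 * (expR (- y) * expR (- y)).
  by rewrite -!expRD; congr expR; rewrite /y; field.
have v0 : 0 < v by lra.
have sq : expR (- y) * expR (- y) < v ^+ 2 / 9 by nra.
have -> : 2 * expR 3 / 9 = expR 3 * (v ^+ 2 / 9) * (2 / v ^+ 2).
  by field; rewrite gt_eqF.
rewrite ltr_pM2r ?divr_gt0 ?exprn_gt0// ltr_pM2l ?expR_gt0//.
Qed.

End numeric.

(** * The two inequalities *)

Section bounds_on_Q.
Context {R : realType}.
Local Notation mR := (measurableTypeR R).
Implicit Types (k r j : nat) (t u : R) (f : R -> R).
Local Open Scope ereal_scope.

Lemma expectation_chi r f f1 f2 : C2up f f1 f2 ->
  'E_(chi_prob r)[f] = \int[chi_square_prob r]_y (f (Num.sqrt y))%:E.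
Proof.
move=> fup; rewrite unlock.
have mf : measurable_fun setT (fun x : mR => (f x)%:E : \bar R).
  by apply/measurable_EFinP; exact: (continuous_measurable_fun (C2up_continuous fup)).
have f0 (y : mR) : 0 <= (f y)%:E by rewrite lee_fin (C2up_ge0 fup).
exact: (@ge0_integral_distribution _ _ _ _ R (chi_square_prob r) (@sqrt_fun R) _ mf f0).
Qed.

Lemma Q_le r u f : C2upconv f -> (0 < f u)%R -> Q r u <= 'E_(chi_prob r)[f] * (f u)^-1%:E.
Proof. by move=> cf fu; apply: ereal_inf_lbound; exists f. Qed.

Lemma chi_prob_itv0y r : chi_prob r [set x : R | (0 <= x)%R] = 1.
Proof.
rewrite -[RHS](@probability_setT _ _ _ (chi_square_prob r)).
rewrite [LHS](_ : _ = chi_square_prob r (@sqrt_fun R @^-1` [set x : R | (0 <= x)%R]))//.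
by congr (chi_square_prob r _); apply/seteqP; split => // x _ /=; rewrite sqrtr_ge0.
Qed.

(** The form in which the conclusion of [chi_power_mean_lt] is used: it leaves an
elementary inequality between [l], [u], [t] and [f u]. *)
Lemma Q_lt_tail k u f f1 f2 j t l (c : R) : (0 < l)%R ->
  (\int[chi_prob k.+1]_x (f x)%:E <
   chi_prob k.+1 [set x | u <= x]%R * (expR (l * (u - t)) * (j`!%:R / l ^+ j))%:E) ->
  C2up f f1 f2 -> (0 < f u)%R ->
  (expR (l * (u - t)) * (j`!%:R / l ^+ j) <= c * f u)%R ->
  Q k.+1 u < c%:E * chi_prob k.+1 [set x | u <= x]%R.
Proof.
move=> l0 lt fup fu cle.
have cf : C2upconv f by apply/C2upconvP; exists f1, f2.
apply: (le_lt_trans (Q_le _ cf fu)).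
rewrite unlock lte_pdivrMr//.
apply: (lt_le_trans lt).
rewrite muleAC -EFinM [leRHS]muleC.
by rewrite lee_pmul// lee_fin// mulr_ge0 ?expR_ge0 ?divr_ge0 ?exprn_ge0 ?ltW.
Qed.

(** With [v = l * u], the test functions are 1 for small [v], the square in an
intermediate range, and for [3 <= v] the cubic hinge with knot [t = u - 3 / l],
which minimizes [expR (l * (u - t)) * 6 / (l * (u - t)) ^+ 3] and gives the
constant exactly; the strict inequality is then that of [chi_power_mean_lt]. *)
Theorem Q_lt k u : (0 <= u)%R ->
  Q k.+1 u < (2 * expR 3 / 9)%:E * chi_prob k.+1 [set x | u <= x]%R.
Proof.
rewrite le_eqVlt => /orP[/eqP<-|u0].
  rewrite chi_prob_itv0y mule1.
  have cf1 : C2upconv (fun=> 1 : R)%R by apply/C2upconvP; exists (fun=> 0%R), (fun=> 0%R);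
    exact: C2up_cst1.
  apply: (le_lt_trans (Q_le _ cf1 ltr01)).
  rewrite expectation_cst invr1 mule1 lte_fin.
  have := @expR_lt_small R 0; rewrite expR0; apply; lra.
have [l l0 hl] := chi_power_mean_lt k u0.
have mf f f1 f2 : C2up f f1 f2 -> measurable_fun setT (f : mR -> mR).
  by move=> fup; exact: (continuous_measurable_fun (C2up_continuous fup)).
pose v := (l * u)%R.
have [v1|v1] := leP v (7 / 5)%R.
  apply: (Q_lt_tail l0 (hl _ 0%N 0%R _ _ _ _) C2up_cst1) => //.
  - by move=> x x0; rewrite ltW.
  - by rewrite subr0 expr0 divr1 !mulr1; exact/ltW/expR_lt_small.
have [v3|v3] := ltP v 3%R.
  apply: (Q_lt_tail l0 (hl _ 2%N 0%R (mf _ _ _ C2up_sqr) _ _ _) C2up_sqr) => //.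
  - by move=> x; exact: sqr_ge0.
  - by move=> x x0; rewrite ltW// subr0.
  - by rewrite exprn_gt0.
  - have := ltW (expR_lt_mid (ltW v1) v3).
    rewrite subr0 -[(l * u)%R]/v => h.
    have u2 : (0 < u ^+ 2)%R by rewrite exprn_gt0.
    rewrite -ler_pdivrMr//; apply: le_trans h; rewrite le_eqVlt; apply/orP; left; apply/eqP.
    by rewrite (_ : 2`!%:R = 2 :> R)%R// /v; field; rewrite !gt_eqF.
have t0 : (0 <= u - 3 / l)%R by rewrite subr_ge0 ler_pdivrMr// mulrC.
have tu : (u - 3 / l < u)%R by rewrite ltrBlDr ltrDl divr_gt0.
have cup := C2up_cubic_hinge (u - 3 / l).
have fuE : cubic_hinge (u - 3 / l) u = ((3 / l) ^+ 3)%R.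
  by rewrite cubic_hingeE// ?(ltW u0)// (ltW tu); congr (_ ^+ 3)%R; ring.
apply: (Q_lt_tail l0 (hl _ 3%N (u - 3 / l)%R (mf _ _ _ cup) _ tu _) cup) => //.
- by move=> x; exact: (C2up_ge0 cup).
- by move=> x x0; rewrite cubic_hingeE// ltW.
- by rewrite fuE exprn_gt0// divr_gt0.
- rewrite fuE (_ : l * (u - (u - 3 / l)) = 3)%R; last by field; rewrite gt_eqF.
  rewrite le_eqVlt; apply/orP; left; apply/eqP.
  by rewrite (_ : 3`!%:R = 6 :> R)%R//; field; rewrite gt_eqF.
Qed.

End bounds_on_Q.

Theorem corollary4p5 (R : realType) (n r : nat) (P : 'M[R]_n)
  (P_sym : P = P^T) (P_idem : P = P *m P) (rankP : \rank P = r) (r_ge1 : (1 <= r)%N)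
  (d : measure_display) (T : measurableType d) (Pr : probability T R)
  (eta : 'I_n -> {RV Pr >-> R})
  (eta_indep : mutually_independent eta)
  (eta_mean : forall i, ('E_Pr[eta i] = 0)%E)
  (eta_bound : forall i, Pr [set w | `|eta i w| <= 1] = 1%E)
  (u : R) (u_ge0 : 0 <= u) :
  let etav (w : T) : 'cV[R]_n := \col_i eta i w in
  (Pr [set w | u ^+ 2 <= ((etav w)^T *m P *m etav w) 0 0]%R <= Q r u)%E /\
  (Q r u < (2 * expR 3 / 9)%:E * chi_prob r [set x | u <= x]%R)%E.
Proof.
move=> etav; case: r rankP r_ge1 => // k rankP _; split; last exact: Q_lt.
apply/ereal_infP => _ [f [cf fu] <-].
have [f1 [f2 fup]] := (C2upconvP f).1 cf.
rewrite (expectation_chi _ fup) lee_pdivlMr// muleC -rankP.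
exact: (projector_tail eta_indep eta_mean eta_bound P_sym P_idem fup u_ge0).
Qed.
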